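(* Let $f:(M,g)\to(\bar M,\bar g)$ be a smooth harmonic map from an $n$-dimensional connected, compact Riemannian manifold $(M,g)$ without boundary into a connected Riemannian manifold $(\bar M,\bar g)$. Let $$\mathrm{Ric}_{\min}(M)=\min_{p\in M}\ \min_{X\in T_pM,\ |X|=1}\mathrm{Ric}_M(X,X)$$ be the global minimum of the Ricci curvature of $(M,g)$, and let $$\overline{\mathrm{Sec}}_{\max}(f(M))=\max_{q\in f(M),\ \sigma\subset T_q\bar M}\overline{\mathrm{Sec}}(\sigma)$$ be the maximum of the sectional curvature of $(\bar M,\bar g)$ over all two-planes $\sigma\subset T_q\bar M$ at points $q$ of the image $f(M)$. Assume that $\overline{\mathrm{Sec}}(\sigma)\ge 0$ for every two-plane $\sigma\subset T_q\bar M$ at each point $q\in f(M)$, and that $$\mathrm{Ric}_{\min}(M)>\frac{n-1}{n}\,\overline{\mathrm{Sec}}_{\max}(f(M))\cdot\sup_M|df|^2 .$$ Then $f$ is constant.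
   Context: $\mathrm{Ric}_M$ is the Ricci tensor of $(M,g)$ and $\overline{\mathrm{Sec}}$ is the sectional curvature of $(\bar M,\bar g)$. The two-planes $\sigma$ range over all two-dimensional subspaces of $T_q\bar M$, not only those tangent to $f(M)$. The norm is $|df|^2=\mathrm{tr}_g(f^*\bar g)=\sum_{i}\bar g(df(e_i),df(e_i))$ for a local $g$-orthonormal frame $\{e_i\}$. A smooth map is harmonic if it is a critical point of $E(f)=\frac12\int_M|df|^2\,d\mathrm{vol}_g$, equivalently if $\mathrm{tr}_g\nabla df=0$. *)

(* Defs.v *)
From mathcomp Require Import all_boot all_order all_algebra.
From mathcomp Require Import all_classical all_reals all_analysis.

Set Implicit Arguments.
Unset Strict Implicit.
Unset Printing Implicit Defensive.

Import Order.TTheory GRing.Theory Num.Theory.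
Import numFieldNormedType.Exports.

Local Open Scope classical_set_scope.
Local Open Scope ring_scope.

(* Points and tangent vectors of R^n are row vectors 'rV[R]_n; the partial    *)
(* derivative d_i is the library's directional derivative along ebase i.      *)
Definition ebase (R : realType) (n : nat) (i : 'I_n) : 'rV[R]_n := delta_mx 0 i.

Fixpoint Ck (R : realType) (n : nat) (W : normedModType R) (k : nat)
    (U : set 'rV[R]_n) (F : 'rV[R]_n -> W) : Prop :=
  match k with
  | 0 => forall x, U x -> {for x, continuous F}
  | k'.+1 => (forall x, U x -> differentiable F x) /\
             (forall i : 'I_n, Ck k' U ('D_(ebase R i) F))
  end.

Definition smooth_on (R : realType) (n : nat) (W : normedModType R)
    (U : set 'rV[R]_n) (F : 'rV[R]_n -> W) : Prop :=
  forall k, Ck k U F.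

(* The inverse chart is a total function; only its values on                  *)
(* chart_map @` chart_dom are meaningful.                                     *)
Record chart (R : realType) (n : nat) (T : topologicalType) := Chart {
  chart_dom : set T ;
  chart_map : T -> 'rV[R]_n ;
  chart_inv : 'rV[R]_n -> T ;
  chart_dom_open : open chart_dom ;
  chart_img_open : open (chart_map @` chart_dom) ;
  chart_mapK : forall p, chart_dom p -> chart_inv (chart_map p) = p ;
  chart_map_cont : {within chart_dom, continuous chart_map} ;
  chart_inv_cont : {within chart_map @` chart_dom, continuous chart_inv} }.

Definition chart_transition (R : realType) (n : nat) (T : topologicalType)
    (c d : chart R n T) : 'rV[R]_n -> 'rV[R]_n :=
  chart_map d \o chart_inv c.

(* Charts take values in open subsets of R^n: manifolds have no boundary.     *)
Record smoothManifold (R : realType) (n : nat) := SmoothManifold {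
  carrier :> topologicalType ;
  atlas : set (chart R n carrier) ;
  manifold_hausdorff : hausdorff_space carrier ;
  manifold_second_countable : @second_countable carrier ;
  atlas_cover : forall p : carrier, exists2 c, atlas c & chart_dom c p ;
  atlas_smooth : forall c d, atlas c -> atlas d ->
    smooth_on (chart_map c @` (chart_dom c `&` chart_dom d))
              (chart_transition c d) }.

(* The metric is given by its component matrices (g_ij) in the charts of the  *)
(* atlas, related by the tensor law g_ij = d_i y^a d_j y^b g'_ab (the library *)
(* Jacobian has entries ('J y x) i a = d_i y^a).                              *)
Record riemannianMetric (R : realType) (n : nat) (M : smoothManifold R n) :=
  RiemannianMetric {
  metric_mx :> chart R n M -> 'rV[R]_n -> 'M[R]_n ;
  metric_smooth : forall c, atlas c ->
    smooth_on (chart_map c @` chart_dom c) (metric_mx c) ;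
  metric_sym : forall c p, atlas c -> chart_dom c p ->
    (metric_mx c (chart_map c p))^T = metric_mx c (chart_map c p) ;
  metric_pos : forall c p (v : 'rV[R]_n), atlas c -> chart_dom c p -> v != 0 ->
    0 < (v *m metric_mx c (chart_map c p) *m v^T) 0 0 ;
  metric_change : forall c d p, atlas c -> atlas d ->
    chart_dom c p -> chart_dom d p ->
    let J := 'J (chart_transition c d) (chart_map c p) in
    metric_mx c (chart_map c p) = J *m metric_mx d (chart_map d p) *m J^T }.

Section LocalGeometry.
Context {R : realType} {n : nat}.
Variable G : 'rV[R]_n -> 'M[R]_n.
Implicit Types (x X Y Z : 'rV[R]_n) (i j k l : 'I_n).

Definition inner x X Y : R := (X *m G x *m Y^T) 0 0.

(* Gamma^k_ij of the Levi-Civita connection *)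
Definition christoffel k i j x : R :=
  2^-1 * \sum_l (invmx (G x)) k l *
    (('D_(ebase R i) G x) j l + ('D_(ebase R j) G x) i l
     - ('D_(ebase R l) G x) i j).

(* the l-th component of R(d_i, d_j) d_k, where
   R(X, Y) Z = nabla_X nabla_Y Z - nabla_Y nabla_X Z - nabla_[X,Y] Z *)
Definition riemann_coef l k i j x : R :=
  'D_(ebase R i) (christoffel l j k : 'rV[R]_n -> R^o) x
  - 'D_(ebase R j) (christoffel l i k : 'rV[R]_n -> R^o) x
  + \sum_h (christoffel l i h x * christoffel h j k x
            - christoffel l j h x * christoffel h i k x).

Definition riemann x X Y Z : 'rV[R]_n :=
  \row_l \sum_i \sum_j \sum_k X 0 i * Y 0 j * Z 0 k * riemann_coef l k i j x.

(* the trace of X |-> R(X, Y) Z *)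
Definition ricci x Y Z : R := \sum_i riemann x (ebase R i) Y Z 0 i.

(* the sectional curvature of the plane spanned by X and Y *)
Definition sectional x X Y : R :=
  inner x (riemann x X Y Y) X
  / (inner x X X * inner x Y Y - inner x X Y ^+ 2).

End LocalGeometry.

Section LocalMaps.
Context {R : realType} {n m : nat}.
Variables (G : 'rV[R]_n -> 'M[R]_n) (H : 'rV[R]_m -> 'M[R]_m).
Variable F : 'rV[R]_n -> 'rV[R]_m.

(* tr_G (F^* H) *)
Definition energy_density_loc x : R :=
  \tr (invmx (G x) *m ('J F x *m H (F x) *m ('J F x)^T)).

(* the component (nabla dF)^a_ij of the second fundamental form of F *)
Definition nabla_d (a : 'I_m) (i j : 'I_n) x : R :=
  ('D_(ebase R i) ('D_(ebase R j) F) x) 0 a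
  - \sum_k christoffel G k i j x * 'J F x k a
  + \sum_b \sum_c christoffel H a b c (F x) * 'J F x i b * 'J F x j c.

Definition tension_loc x : 'rV[R]_m :=
  \row_a \sum_i \sum_j (invmx (G x)) i j * nabla_d a i j x.

End LocalMaps.

Section Maps.
Context {R : realType} {n m : nat}.
Variables (M : smoothManifold R n) (N : smoothManifold R m).
Implicit Types (f : M -> N) (g : riemannianMetric M) (h : riemannianMetric N).

Definition local_rep f (c : chart R n M) (d : chart R m N) :
  'rV[R]_n -> 'rV[R]_m := chart_map d \o f \o chart_inv c.

Definition smooth_map f : Prop :=
  continuous f /\
  forall c d, atlas c -> atlas d ->
    smooth_on (chart_map c @` (chart_dom c `&` f @^-1` chart_dom d))
              (local_rep f c d).

Definition harmonic_map g h f : Prop :=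
  forall c d p, atlas c -> atlas d -> chart_dom c p -> chart_dom d (f p) ->
    tension_loc (g c) (h d) (local_rep f c d) (chart_map c p) = 0.

(* The quantities below do not depend on the charts used to compute them.     *)

(* the values |df|^2(p), without the factor 1/2 of the energy *)
Definition sqnorm_d_values g h f : set R :=
  [set r | exists c d p, [/\ atlas c, atlas d, chart_dom c p, chart_dom d (f p)
    & r = energy_density_loc (g c) (h d) (local_rep f c d) (chart_map c p)]].

Definition sup_sqnorm_d g h f : R := sup (sqnorm_d_values g h f).

End Maps.

Section Curvature.
Context {R : realType} {n : nat} {M : smoothManifold R n}.
Variable g : riemannianMetric M.

Definition ricci_values : set R :=
  [set r | exists c p (X : 'rV[R]_n), [/\ atlas c, chart_dom c p,
    inner (g c) (chart_map c p) X X = 1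
    & r = ricci (g c) (chart_map c p) X X]].

(* A minimum when M is compact and of positive dimension. *)
Definition ricci_min : R := inf ricci_values.

(* Two-planes at q are the spans of free pairs of tangent vectors at q.       *)
Definition sectional_values (A : set M) : set R :=
  [set r | exists d q (X Y : 'rV[R]_n), [/\ A q, atlas d, chart_dom d q,
    free [:: X; Y]
    & r = sectional (g d) (chart_map d q) X Y]].

(* A maximum when A is compact, nonempty and the dimension is at least 2; the *)
(* convention sup set0 = 0 covers the case where there is no two-plane.       *)
Definition sectional_max (A : set M) : R := sup (sectional_values A).

End Curvature.

(* Main.v *)
Require Import Defs.
From HB Require Import structures.
From mathcomp Require Import all_boot all_order all_algebra.
From mathcomp Require Import all_classical all_reals all_analysis.
From mathcomp Require Import ring lra.

(* Idea: at a maximum p of u = |df|^2 on the compact manifold M, the Hessian of u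
   is nonpositive, whereas Bochner's formula for a harmonic map gives, in
   orthonormal frames (e_i) of T_pM and (w_a) of the target,
     1/2 Delta u = |nabla df|^2 + sum_a Ric(df^* w_a, df^* w_a)
                   - sum_ij <R(df e_i, df e_j) df e_j, df e_i>.
   The middle sum is at least Ric_min u, and the last one is at most
   Sec_max sum_ij (|df e_i|^2 |df e_j|^2 - <df e_i, df e_j>^2)
   <= (n-1)/n Sec_max u^2 by Cauchy-Schwarz.  Hence u(p) > 0 would contradict the
   pinching hypothesis, so df = 0 and f is locally constant.

   Connections act on n x m matrices of components by D_k X = d_k X - A_k X + X B_k,
   where A_k and B_k are the matrices of Christoffel symbols of M and of the
   pulled-back connection; the same calculus, applied to a change of charts (for
   which dF is parallel), gives the invariance of the sectional curvature. *)

Set Implicit Arguments.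
Unset Strict Implicit.
Unset Printing Implicit Defensive.
Import Order.TTheory GRing.Theory Num.Theory.
Import numFieldNormedType.Exports.
Local Open Scope classical_set_scope.
Local Open Scope ring_scope.

(** * Smooth functions on open subsets of R^n *)

(** [inf] and [sup] are real numbers with default value 0 when the infimum or supremum does not
    exist, so neither pinching constant bounds anything until that case is excluded. For the Ricci
    minimum the pinching hypothesis itself does it, since it forces a positive value. For the
    sectional maximum boundedness has to be proved: near each point of M the curvatures at the image
    are bounded by a continuous function computed in a single chart, and compactness of M makes the
    bound uniform. This is where the sectional curvature must be compared across charts. Bochner's
    formula is established in arbitrary coordinates, at a critical point of u, without normal
    coordinates or moving frames; frames enter only pointwise, through factorisations of the inverse
    metric of M and of the metric of the target. Since the maximum is global while the computation
    stays in one chart, u must also be shown independent of the charts. *)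

Lemma near_eq_differentiable (R : numFieldType) (V W : normedModType R)
    (f g : V -> W) (x : V) :
  (\forall y \near x, f y = g y) -> differentiable f x -> differentiable g x.
Proof.
move=> fg df.
(* g is f plus a function vanishing near x, whose differential at x is the null map. *)
pose h y := g y - f y.
have -> : g = f + h by apply/funext => y; transitivity (f y + h y) => //; rewrite addrC subrK.
apply: differentiableD => //.
have h0 : \forall y \near x, h y = 0.
  by apply: filterS fg => y fgy; rewrite /h fgy subrr.
have sx : (y + x) @[y --> (0 : V)] --> x.
  by rewrite -[X in _ --> X]add0r; apply: cvgD; [exact: cvg_id|exact: cvg_cst].
have hs0 : \forall y \near (0 : V), h (y + x) = 0 by exact: (sx _ h0).
have hE : h \o shift x = cst (h x) + (\0 : {linear V -> W}) +o_ 0 id.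
  apply/eqaddoE/eqaddoP => e e0; near=> y.
  have hy0 : h (y + x) = 0.
    by near: y; exact: hs0.
  have -> : (h \o shift x - (cst (h x) + (\0 : {linear V -> W}))) y = 0.
    transitivity (h (y + x) - (h x + 0)) => //.
    by rewrite hy0 (nbhs_singleton h0) addr0 subr0.
  by rewrite normr0 mulr_ge0// ltW.
have c0 : continuous (\0 : {linear V -> W}) by move=> y; exact: cst_continuous.
have dh := diff_unique c0 hE.
by apply/diff_locallyP; rewrite dh; split.
Unshelve. all: by end_near. Qed.

Section Ck.
Context {R : realType} {n : nat}.
Implicit Types (U V : set 'rV[R]_n) (k : nat) (i j : 'I_n).

Lemma open_near_eq {T : Type} U (F G : 'rV[R]_n -> T) x :
  open U -> U x -> (forall y, U y -> F y = G y) -> \forall y \near x, F y = G y.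
Proof.
move=> oU Ux FG; have := open_nbhs_nbhs (conj oU Ux).
by apply: filterS => y; exact: FG.
Qed.

Lemma Ck_ext {W : normedModType R} k U (F G : 'rV[R]_n -> W) :
  open U -> (forall x, U x -> F x = G x) -> Ck k U F -> Ck k U G.
Proof.
move=> oU; elim: k F G => [|k IH] F G FG /= => [cF x Ux|[dF DF]].
  have nFG := open_near_eq oU Ux FG.
  rewrite /prop_for /continuous_at -(FG _ Ux).
  by apply: cvg_trans (cF _ Ux); apply: (@near_eq_cvg _ _ (nbhs x)).
split=> [x Ux|i].
  exact: near_eq_differentiable (open_near_eq oU Ux FG) (dF _ Ux).
apply: IH (DF i) => x Ux.
exact: near_eq_derive (open_near_eq oU Ux FG).
Qed.

Lemma Ck_sub {W : normedModType R} k U V (F : 'rV[R]_n -> W) :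
  V `<=` U -> Ck k U F -> Ck k V F.
Proof.
move=> VU; elim: k F => [|k IH] F /= => [cF x /VU|[dF DF]]; first exact: cF.
by split=> [x /VU|i]; [exact: dF|exact/IH/DF].
Qed.

Lemma CkW {W : normedModType R} k U (F : 'rV[R]_n -> W) :
  Ck k.+1 U F -> Ck k U F.
Proof.
elim: k F => [|k IH] F [dF DF] /=.
  by move=> x /dF; exact: differentiable_continuous.
by split=> // i; exact/IH/DF.
Qed.

Lemma Ck_linear {W W' : normedModType R} (L : {linear W -> W'}) k U
    (F : 'rV[R]_n -> W) :
  continuous L -> open U -> Ck k U F -> Ck k U (L \o F).
Proof.
move=> cL oU; elim: k F => [|k IH] F /= => [cF x Ux|[dF DF]].
  by apply: continuous_comp; [exact: cF|exact: cL].
split=> [x Ux|i].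
  by apply: differentiable_comp; [exact: dF|exact: linear_differentiable].
apply: Ck_ext oU _ (IH _ (DF i)) => x Ux /=.
have dL : differentiable L (F x) by exact: linear_differentiable.
have dFx := dF _ Ux.
rewrite (deriveE _ dFx) (deriveE _ (differentiable_comp dFx dL)).
by rewrite (diff_comp dFx dL) (diff_lin _ cL).
Qed.

Lemma smooth_on_entry {p q} U (A : 'rV[R]_n -> 'M[R]_(p, q)) a b :
  open U -> smooth_on U A -> smooth_on U ((fun x => A x a b) : _ -> R^o).
Proof.
move=> oU sA k.
have @L : {linear 'M[R]_(p, q) -> R^o}.
  by exists (fun N : 'M[R]_(_, _) => N a b); do 2![eexists]; do ?[constructor];
     rewrite ?mxE// => ? *; rewrite ?mxE//; move=> ?; rewrite !mxE.
rewrite (_ : (fun x => _) = L \o A) //; apply: Ck_linear => //.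
exact: coord_continuous.
Qed.

End Ck.

(* Locked so that unification does not unfold directional derivatives to limits. *)
HB.lock Definition pd (R : realType) (n : nat) (i : 'I_n) (f : 'rV[R]_n -> R) :
  'rV[R]_n -> R := 'D_(ebase R i) (f : 'rV[R]_n -> R^o).
Arguments pd {R n} i f.

Section ScalarCalculus.
Context {R : realType} {n : nat}.
Implicit Types (U V : set 'rV[R]_n) (f g : 'rV[R]_n -> R) (i j : 'I_n).

Lemma pdE i f : pd i f = 'D_(ebase R i) (f : 'rV[R]_n -> R^o).
Proof. by rewrite pd.unlock. Qed.

Definition smf U f : Prop := smooth_on U (f : 'rV[R]_n -> R^o).

Lemma smf_differentiable U f x :
  smf U f -> U x -> differentiable (f : 'rV[R]_n -> R^o) x.
Proof. by move=> /(_ 1%N)[+ _]; apply. Qed.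

Lemma smf_derivable U f x v :
  smf U f -> U x -> derivable (f : 'rV[R]_n -> R^o) x v.
Proof. by move=> sf Ux; apply: diff_derivable; exact: smf_differentiable Ux. Qed.

Lemma smf_continuous U f x :
  smf U f -> U x -> {for x, continuous (f : 'rV[R]_n -> R^o)}.
Proof. by move=> /(_ 0%N); apply. Qed.

Lemma smf_pd U f i : smf U f -> smf U (pd i f).
Proof. by rewrite pdE => sf k; have [_] := sf k.+1; apply. Qed.

Lemma smf_ext U f g : open U -> (forall x, U x -> f x = g x) -> smf U f -> smf U g.
Proof. by move=> oU fg sf k; exact: Ck_ext oU fg (sf k). Qed.

Lemma smf_sub U V f : V `<=` U -> smf U f -> smf V f.
Proof. by move=> VU sf k; exact: Ck_sub VU (sf k). Qed.

Lemma pd_ext U f g i x :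
  open U -> U x -> (forall y, U y -> f y = g y) -> pd i f x = pd i g x.
Proof. by rewrite !pdE => oU Ux fg; apply: near_eq_derive; exact: open_near_eq fg. Qed.

Lemma pd_cst (c : R) i x : pd i (fun=> c) x = 0.
Proof. by rewrite pdE; exact: derive_cst. Qed.

Lemma pdD U f g i x : smf U f -> smf U g -> U x ->
  pd i (fun y => f y + g y) x = pd i f x + pd i g x.
Proof. by rewrite !pdE => sf sg Ux; apply: deriveD; apply: smf_derivable Ux. Qed.

Lemma pdN U f i x : smf U f -> U x -> pd i (fun y => - f y) x = - pd i f x.
Proof. by rewrite !pdE => sf Ux; apply: deriveN; apply: smf_derivable Ux. Qed.

Lemma pdM U f g i x : smf U f -> smf U g -> U x ->
  pd i (fun y => f y * g y) x = pd i f x * g x + f x * pd i g x.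
Proof.
move=> sf sg Ux; rewrite addrC !pdE.
rewrite [LHS](deriveM (smf_derivable (v:=ebase R i) sf Ux) (smf_derivable sg Ux)).
by rewrite [in X in _ + X]/GRing.scale /= [X in _ + X]mulrC.
Qed.

Lemma smf_cst U c : smf U (fun=> c).
Proof.
move=> k; elim: k c => [|k IH] c /=; first by move=> x _; exact: cst_continuous.
split=> [x _|i]; first exact: differentiable_cst.
have -> : 'D_(ebase R i) ((fun=> c) : 'rV[R]_n -> R^o) = (fun=> 0).
  by apply/funext => x; exact: derive_cst.
exact: IH.
Qed.

Lemma CkD k U f g : open U -> Ck k U (f : _ -> R^o) -> Ck k U (g : _ -> R^o) ->
  Ck k U ((fun x => f x + g x) : _ -> R^o).
Proof.
move=> oU; elim: k f g => [|k IH] f g /= => [cf cg x Ux|[df Df] [dg Dg]].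
  exact: (continuousD (cf _ Ux) (cg _ Ux)).
split=> [x Ux|i]; first by apply: differentiableD; [exact: df|exact: dg].
apply: Ck_ext oU _ (IH _ _ (Df i) (Dg i)) => x Ux.
by apply/esym/deriveD; apply: diff_derivable; [exact: df|exact: dg].
Qed.

Lemma CkM k U f g : open U -> Ck k U (f : _ -> R^o) -> Ck k U (g : _ -> R^o) ->
  Ck k U ((fun x => f x * g x) : _ -> R^o).
Proof.
move=> oU; elim: k f g => [|k IH] f g => [cf cg x Ux|Cf Cg].
  exact: (continuousM (cf _ Ux) (cg _ Ux)).
have [df Df] := Cf; have [dg Dg] := Cg.
split=> [x Ux|i]; first by apply: differentiableM; [exact: df|exact: dg].
(* The Leibniz rule brings back f and g themselves, which [CkW] lowers to class k. *)
apply: Ck_ext oU _ (CkD oU (IH _ _ (CkW Cf) (Dg i)) (IH _ _ (CkW Cg) (Df i))).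
by move=> x Ux; apply/esym/deriveM; apply: diff_derivable; [exact: df|exact: dg].
Qed.

Lemma smfD U f g : open U -> smf U f -> smf U g -> smf U (fun x => f x + g x).
Proof. by move=> oU sf sg k; exact: CkD. Qed.

Lemma smfM U f g : open U -> smf U f -> smf U g -> smf U (fun x => f x * g x).
Proof. by move=> oU sf sg k; exact: CkM. Qed.

Lemma smfN U f : open U -> smf U f -> smf U (fun x => - f x).
Proof.
move=> oU sf; apply: smf_ext oU _ (smfM oU (smf_cst U (-1)) sf) => x _.
by rewrite mulN1r.
Qed.

Lemma smf_sum U (I : Type) (r : seq I) (P : pred I) (F : I -> 'rV[R]_n -> R) :
  open U -> (forall a, P a -> smf U (F a)) ->
  smf U (fun x => \sum_(a <- r | P a) F a x).
Proof.
move=> oU sF; elim: r => [|a r IH].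
  by apply: smf_ext oU _ (smf_cst U 0) => x _; rewrite big_nil.
case Pa : (P a).
  apply: smf_ext oU _ (smfD oU (sF _ Pa) IH) => x _.
  by rewrite big_cons Pa.
by apply: smf_ext oU _ IH => x _; rewrite big_cons Pa.
Qed.

Lemma smf_prod U (I : Type) (r : seq I) (P : pred I) (F : I -> 'rV[R]_n -> R) :
  open U -> (forall a, P a -> smf U (F a)) ->
  smf U (fun x => \prod_(a <- r | P a) F a x).
Proof.
move=> oU sF; elim: r => [|a r IH].
  by apply: smf_ext oU _ (smf_cst U 1) => x _; rewrite big_nil.
case Pa : (P a).
  apply: smf_ext oU _ (smfM oU (sF _ Pa) IH) => x _.
  by rewrite big_cons Pa.
by apply: smf_ext oU _ IH => x _; rewrite big_cons Pa.
Qed.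

Lemma pd_sum U (I : Type) (r : seq I) (P : pred I) (F : I -> 'rV[R]_n -> R) i x :
  open U -> (forall a, P a -> smf U (F a)) -> U x ->
  pd i (fun x => \sum_(a <- r | P a) F a x) x = \sum_(a <- r | P a) pd i (F a) x.
Proof.
move=> oU sF Ux; elim: r => [|a r IH].
  rewrite big_nil -[RHS](pd_cst 0 i x); apply: pd_ext oU Ux _ => y _.
  by rewrite big_nil.
rewrite big_cons; case Pa : (P a).
  rewrite -IH -(pdD (U:=U)) //; last 2 first.
  - exact: sF.
  - exact: smf_sum.
  by apply: pd_ext oU Ux _ => y _; rewrite big_cons Pa.
by rewrite -IH; apply: pd_ext oU Ux _ => y _; rewrite big_cons Pa.
Qed.

(** Induction on the class: the derivative of 1/f is -(1/f)^2 times that of f, where 1/f is already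
    known to be of class k. *)
Lemma smfV U f : open U -> (forall x, U x -> f x != 0) -> smf U f ->
  smf U (fun x => (f x)^-1).
Proof.
move=> oU f0 sf k; elim: k => [|k IH].
  by move=> x Ux; apply: (continuousV (f0 _ Ux)); exact: smf_continuous Ux.
split=> [x Ux|i].
  by apply: differentiableV; [exact: smf_differentiable Ux|exact: f0].
have C2 := CkM oU IH IH.
apply: Ck_ext oU _ (CkM oU (smf_cst U (-1) k) (CkM oU C2 (smf_pd i sf k))).
move=> x Ux; rewrite pdE [RHS](deriveV (f0 _ Ux) (smf_derivable sf Ux)).
by rewrite /GRing.scale /= mulN1r mulNr -invfM expr2.
Qed.

Lemma smf_det U p (A : 'rV[R]_n -> 'M[R]_p) : open U ->
  (forall a b, smf U (fun x => A x a b)) -> smf U (fun x => \det (A x)).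
Proof.
move=> oU sA; apply: smf_sum => // s _; apply: smfM => //; first exact: smf_cst.
by apply: smf_prod.
Qed.

(* By Cramer's rule. *)
Lemma smf_invmx U p (A : 'rV[R]_n -> 'M[R]_p) : open U ->
  (forall x, U x -> A x \in unitmx) ->
  (forall a b, smf U (fun x => A x a b)) ->
  forall a b, smf U (fun x => (invmx (A x)) a b).
Proof.
move=> oU uA sA a b.
have sc : smf U (fun x => cofactor (A x) b a).
  rewrite /cofactor; apply: smfM => //; first exact: smf_cst.
  apply: smf_det => // c d; apply: smf_ext oU _ (sA (lift b c) (lift a d)) => x _.
  by rewrite !mxE.
have sd : smf U (fun x => (\det (A x))^-1).
  apply: smfV => //; last exact: smf_det.
  by move=> x /uA; rewrite unitmxE unitfE.
apply: smf_ext oU _ (smfM oU sd sc) => x Ux.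
by rewrite /invmx uA// !mxE.
Qed.

Lemma derive_pd U f x v : smf U f -> U x ->
  'D_v (f : 'rV[R]_n -> R^o) x = \sum_i v 0 i * pd i f x.
Proof.
move=> sf Ux; have df := smf_differentiable sf Ux.
rewrite deriveE // {1}(row_sum_delta v) linear_sum /=.
by apply: eq_bigr => i _; rewrite pdE linearZ /= -deriveE ?pdE.
Qed.

End ScalarCalculus.

Section ChainRule.
Context {R : realType} {n m : nat}.
Implicit Types (U : set 'rV[R]_n) (V : set 'rV[R]_m) (i : 'I_n) (a : 'I_m).
Implicit Types (phi : 'rV[R]_n -> 'rV[R]_m) (f : 'rV[R]_m -> R).

Lemma derive_entry p q (A : 'rV[R]_n -> 'M[R]_(p, q)) (x v : 'rV[R]_n)
    (a : 'I_p) (b : 'I_q) :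
  differentiable A x -> ('D_v A x) a b = 'D_v ((fun y => A y a b) : _ -> R^o) x.
Proof. by move=> dA; rewrite derive_mx ?mxE//; exact: diff_derivable. Qed.

Lemma jacobianE phi x i a : differentiable phi x ->
  'J phi x i a = pd i (fun y => phi y 0 a) x.
Proof.
move=> dphi; rewrite pdE; transitivity (('D_(ebase R i) phi x) 0 a).
  by rewrite deriveEjacobian// /ebase -rowE [RHS]mxE.
exact: derive_entry.
Qed.

Lemma smooth_on_smf U phi a : open U -> smooth_on U phi ->
  smf U (fun y => phi y 0 a).
Proof. by move=> oU sphi; exact: smooth_on_entry. Qed.

Lemma smooth_on_differentiable U phi x : smooth_on U phi -> U x ->
  differentiable phi x.
Proof. by move=> /(_ 1%N)[+ _]; apply. Qed.

Lemma pd_comp phi f i x : differentiable phi x ->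
  differentiable (f : _ -> R^o) (phi x) ->
  pd i (f \o phi) x = \sum_a pd a f (phi x) * pd i (fun y => phi y 0 a) x.
Proof.
move=> dphi df; have dc := differentiable_comp dphi df.
rewrite pdE [LHS](deriveE _ dc) (diff_comp dphi df) /= -(deriveE _ dphi).
rewrite {1}(row_sum_delta ('D_(ebase R i) phi x)) linear_sum /=.
apply: eq_bigr => a _; rewrite !pdE linearZ /= -(deriveE _ df) (derive_entry _ _ _ dphi).
exact: mulrC.
Qed.

Lemma smf_comp U V phi f : open U -> smooth_on U phi ->
  (forall x, U x -> V (phi x)) -> smf V f -> smf U (f \o phi).
Proof.
move=> oU sphi UV sf k; elim: k f sf => [|k IH] f sf.
  move=> x Ux; apply: continuous_comp.
    by apply: differentiable_continuous; exact: smooth_on_differentiable Ux.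
  by apply: smf_continuous sf _; exact: UV.
split=> [x Ux|i].
  apply: differentiable_comp; first exact: smooth_on_differentiable Ux.
  by apply: smf_differentiable sf _; exact: UV.
(* The induction hypothesis only gives class [k], so [smf_sum] does not apply to the sum of the
   chain rule. *)
have CkS r (F : 'I_m -> 'rV[R]_n -> R) : (forall a, Ck k U (F a : _ -> R^o)) ->
    Ck k U ((fun x => \sum_(a <- r) F a x) : _ -> R^o).
  move=> CF; elim: r => [|a r IHr].
    by apply: Ck_ext oU _ (smf_cst U 0 k) => x _; rewrite big_nil.
  by apply: Ck_ext oU _ (CkD oU (CF a) IHr) => x _; rewrite big_cons.
apply: (Ck_ext (F := fun x => \sum_a (pd a f \o phi) x *
    pd i (fun y => phi y 0 a) x) oU).
  move=> x Ux; transitivity (pd i (f \o phi) x); last by rewrite pdE.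
  rewrite pd_comp//.
    exact: smooth_on_differentiable Ux.
  by apply: smf_differentiable sf _; exact: UV.
apply: CkS => a; apply: CkM => //; first exact: IH (smf_pd a sf).
by apply: smf_pd; exact: smooth_on_smf.
Qed.

End ChainRule.

(** * Mean value theorem, mixed partial derivatives, conditions at a maximum *)

Section MeanValue.
Context {R : realType} {n : nat}.
Implicit Types (U : set 'rV[R]_n) (f : 'rV[R]_n -> R) (i j : 'I_n) (x v : 'rV[R]_n).

Lemma is_derive_line U f x v (s : R) : smf U f -> U (s *: v + x) ->
  is_derive s 1 ((fun t => f (t *: v + x)) : R -> R^o)
    (\sum_i v 0 i * pd i f (s *: v + x)).
Proof.
move=> sf Us; have df := smf_derivable (v := v) sf Us.
have E : (fun h : R => h^-1 *: ((((fun t => f (t *: v + x)) : R -> R^o) \o shift s)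
     (h *: 1) - f (s *: v + x)) : R^o) =
   (fun h : R => h^-1 *: (((f : 'rV[R]_n -> R^o) \o shift (s *: v + x)) (h *: v)
     - f (s *: v + x))).
  by apply/funext => h /=; rewrite [h *: 1]mulr1 scalerDl addrA.
rewrite -(derive_pd v sf Us); apply: DeriveDef; first by rewrite /derivable E.
by rewrite /derive E.
Qed.

Lemma line_MVT U f x v (h : R) : smf U f -> 0 < h ->
  (forall s, 0 <= s <= h -> U (s *: v + x)) ->
  exists2 s, 0 < s < h &
    f (h *: v + x) - f x = (\sum_i v 0 i * pd i f (s *: v + x)) * h.
Proof.
move=> sf h0 Us.
have dl s : 0 <= s <= h -> is_derive s 1 ((fun t => f (t *: v + x)) : R -> R^o)
    (\sum_i v 0 i * pd i f (s *: v + x)).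
  by move=> /Us; exact: is_derive_line.
have [||s] := MVT (f := fun t => f (t *: v + x))
  (df := fun s => \sum_i v 0 i * pd i f (s *: v + x)) h0.
- by move=> s; rewrite in_itv /= => /andP[s0 sh]; apply: dl; rewrite !ltW.
- apply: derivable_within_continuous => s; rewrite in_itv /= => /dl sd.
  exact: (ex_derive (is_derive := sd)).
- by rewrite in_itv /= scale0r add0r subr0 => sh ->; exists s.
Qed.

Lemma ebase_sum i (F : 'I_n -> R) : \sum_k (ebase R i) 0 k * F k = F i.
Proof.
rewrite (bigD1 i)//= big1 ?addr0 => [|k ki]; first by rewrite mxE !eqxx mul1r.
by rewrite mxE eqxx (negbTE ki) mul0r.
Qed.

(** The mean value theorem along e_i, applied to the difference of f at points h e_j apart, and then
    along e_j, applied to [pd i f], turns the quotient into the value of [pd j (pd i f)] at a point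
    close to x; continuity concludes. *)
Lemma clairaut_quotient U f i j x (e : R) : open U -> smf U f -> U x -> 0 < e ->
  exists2 d, 0 < d & forall h, 0 < h < d ->
    `|(f (h *: ebase R i + (h *: ebase R j + x)) - f (h *: ebase R i + x)
       - f (h *: ebase R j + x) + f x) / (h * h) - pd j (pd i f) x| < e.
Proof.
move=> oU sf Ux e0; set g := pd j (pd i f).
have sg : smf U g by do 2!apply: smf_pd.
have gx : \forall y \near x, `|g x - g y| < e.
  by have /cvgrPdist_lt := smf_continuous sg Ux; apply.
have Unx : \forall y \near x, U y by apply: open_nbhs_nbhs.
have /nbhs_ballP[r /= r0 rP] : \forall y \near x, U y /\ `|g x - g y| < e.
  by near=> y; split; near: y.
(* With h < r / c all points s e_i + t e_j + x with 0 <= s, t <= h lie in the ball of radius r; the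
   summand 1 makes c positive without computing norms. *)
pose c := `|ebase R i| + `|ebase R j| + 1.
have c0 : 0 < c by rewrite ltr_wpDl.
exists (r / c); first exact: divr_gt0.
move=> h /andP[h0 hd].
have inU s t : 0 <= s <= h -> 0 <= t <= h ->
    ball x r (s *: ebase R i + (t *: ebase R j + x)).
  move=> /andP[s0 sh] /andP[t0 th]; rewrite -ball_normE /= addrA.
  rewrite opprD addrCA subrr addr0 normrN.
  apply: le_lt_trans (ler_normD _ _) _; rewrite !normrZ !ger0_norm//.
  rewrite ltr_pdivlMr// in hd; apply: le_lt_trans hd.
  rewrite /c !mulrDr mulr1; apply: ler_wpDr; first exact: ltW.
  by rewrite lerD// ler_wpM2r.
have h00 : 0 <= h <= h by rewrite ltW/=.
have line s : 0 <= s <= h -> is_derive s 1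
    ((fun t => f (t *: ebase R i + (h *: ebase R j + x)) - f (t *: ebase R i + x)) : R -> R^o)
    (pd i f (s *: ebase R i + (h *: ebase R j + x)) - pd i f (s *: ebase R i + x)).
  move=> sh.
  have U1 : U (s *: ebase R i + (h *: ebase R j + x)) by have /rP[] := inU _ _ sh h00.
  have U2 : U (s *: ebase R i + x).
    have : 0 <= (0:R) <= h by rewrite lexx ltW.
    by move=> /(inU _ _ sh)/rP[]; rewrite scale0r add0r.
  have D1 := is_derive_line sf U1; have D2 := is_derive_line sf U2.
  by have D := is_deriveB D1 D2; rewrite !ebase_sum in D.
have [||s] := MVT (f := fun t => f (t *: ebase R i + (h *: ebase R j + x)) - f (t *: ebase R i + x))
  (df := fun s => pd i f (s *: ebase R i + (h *: ebase R j + x)) - pd i f (s *: ebase R i + x)) h0.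
- by move=> s; rewrite in_itv /= => /andP[s0 sh]; apply: line; rewrite !ltW.
- apply: derivable_within_continuous => s; rewrite in_itv /= => /line sd.
  exact: (ex_derive (is_derive := sd)).
rewrite in_itv /= => /andP[s0 sh] E.
have sh' : 0 <= s <= h by rewrite !ltW.
have [t /andP[t0 th]] := line_MVT (U := U) (f := pd i f) (x := s *: ebase R i + x)
  (v := ebase R j) (h := h) (smf_pd i sf) h0
  (fun t th => ltac:(rewrite addrCA; exact: (rP _ (inU _ _ sh' th)).1)).
rewrite ebase_sum -/g => E2.
have th' : 0 <= t <= h by rewrite !ltW.
have /rP[_ gH] := inU _ _ sh' th'.
have pE : s *: ebase R i + (t *: ebase R j + x) = t *: ebase R j + (s *: ebase R i + x).
  exact: addrCA.
have qE : s *: ebase R i + (h *: ebase R j + x) = h *: ebase R j + (s *: ebase R i + x).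
  exact: addrCA.
rewrite qE E2 in E; rewrite pE distrC in gH.
have h00' : h != 0 by rewrite gt_eqF.
suff -> : f (h *: ebase R i + (h *: ebase R j + x)) - f (h *: ebase R i + x)
       - f (h *: ebase R j + x) + f x = g (t *: ebase R j + (s *: ebase R i + x)) * (h * h).
  by rewrite mulfK// mulf_neq0.
move: E; rewrite !scale0r !add0r subr0 mulrA => <-.
by ring.
Unshelve. all: by end_near. Qed.

(* Both mixed derivatives are limits of the same symmetric second-difference quotient. *)
Lemma clairaut U f i j x : open U -> smf U f -> U x ->
  pd i (pd j f) x = pd j (pd i f) x.
Proof.
move=> oU sf Ux; apply/eqP; rewrite -subr_eq0 -normr_le0; apply/ler_addgt0Pl => e e0.
have e20 : 0 < e / 2 by rewrite divr_gt0.
have [d1 d10 H1] := clairaut_quotient i j oU sf Ux e20.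
have [d2 d20 H2] := clairaut_quotient j i oU sf Ux e20.
pose h := Num.min d1 d2 / 2.
have m0 : 0 < Num.min d1 d2 by rewrite lt_min d10.
have h0 : 0 < h by rewrite divr_gt0.
have hm : h < Num.min d1 d2 by rewrite ltr_pdivrMr// ltr_pMr// ltr1n.
move: (hm); rewrite lt_min => /andP[hd1 hd2].
have {H1} := H1 h; rewrite h0 hd1 => /(_ isT) H1.
have {H2} := H2 h; rewrite h0 hd2 => /(_ isT) H2.
rewrite addr0 [e]splitr; move: H1 H2.
rewrite [h *: ebase R j + (h *: ebase R i + x)]addrCA.
set A := f _; set B := f _; set C := f _; set D := f x.
rewrite [A - C - B]addrAC; set q := _ / _ => H1 H2.
rewrite -(subrKA q); apply: le_trans (ler_normD _ _) _.
by apply: lerD; [rewrite distrC; exact: ltW H2|exact: ltW H1].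
Qed.

Lemma cvg_line x v : (s *: v + x) @[s --> (0:R)] --> x.
Proof.
have {2}-> : x = 0 *: v + x by rewrite scale0r add0r.
by apply: cvgD; [apply: cvgZr_tmp; exact: cvg_id|exact: cvg_cst].
Qed.

Lemma max_pd0 U f x i : open U -> smf U f -> U x ->
  (forall y, U y -> f y <= f x) -> pd i f x = 0.
Proof.
move=> oU sf Ux fmax.
have cl := @cvg_line x.
have Ux' : nbhs x U by exact: open_nbhs_nbhs.
have : \forall s \near (0:R), U (s *: ebase R i + x) by exact: (cl _ _ Ux').
move=> /nbhs_ballP[r /= r0 rP].
have inU s : s \in `](- r), r[ -> U (s *: ebase R i + x).
  rewrite in_itv /= => sr; apply: rP; rewrite -ball_normE /= sub0r normrN.
  by rewrite ltr_norml.
have dl s (sr : s \in `](- r), r[) := is_derive_line sf (inU s sr).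
have z0 : (0:R) \in `](- r), r[ by rewrite in_itv /= oppr_lt0 r0.
have H := derive1_at_max (f := fun s => f (s *: ebase R i + x)) (a := - r) (b := r)
  (c := 0) _ _ z0 _.
have rr : - r <= r by apply: le_trans (ltW r0); rewrite oppr_le0 ltW.
have /H{}H : forall t, t \in `](- r), r[ -> 
    derivable ((fun s => f (s *: ebase R i + x)) : R -> R^o) t 1.
  by move=> s sr; exact: (ex_derive (is_derive := dl s sr)).
have [] := H rr.
  by move=> t tr; rewrite scale0r add0r; apply: fmax; exact: inU.
move=> _; have [_ ->] := dl _ z0.
by rewrite ebase_sum scale0r add0r.
Qed.

(** Let q be the derivative of f along v. It vanishes at x, and if its own derivative along v were
    positive there, q would be positive at s v + x for all small s > 0; the mean value theorem would
    then make f exceed its maximum on that ray. *)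
Lemma max_hessian_le0 U f x (v : 'rV[R]_n) : open U -> smf U f -> U x ->
  (forall y, U y -> f y <= f x) ->
  \sum_i \sum_j v 0 i * v 0 j * pd i (pd j f) x <= 0.
Proof.
move=> oU sf Ux fmax; rewrite leNgt; apply/negP => c0.
pose q y := \sum_j v 0 j * pd j f y.
have sq : smf U q.
  by apply: smf_sum => // j _; apply: smfM => //; [exact: smf_cst|exact: smf_pd].
have q0 : q x = 0.
  by rewrite /q big1// => j _; rewrite (max_pd0 j oU sf Ux fmax) mulr0.
have Dq : \sum_i v 0 i * pd i q x = \sum_i \sum_j v 0 i * v 0 j * pd i (pd j f) x.
  apply: eq_bigr => i _; rewrite (pd_sum (U := U))//; last first.
    by move=> j _; apply: smfM => //; [exact: smf_cst|exact: smf_pd].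
  rewrite mulr_sumr; apply: eq_bigr => j _.
  rewrite (pdM (U := U))//; [|exact: smf_cst|exact: smf_pd].
  by rewrite pd_cst mul0r add0r mulrA.
rewrite -Dq in c0.
have cl := @cvg_line x v.
have Ux' : nbhs x U by exact: open_nbhs_nbhs.
have Un : \forall s \near (0:R), U (s *: v + x) by exact: (cl _ Ux').
have Us0 : U (0 *: v + x) by rewrite scale0r add0r.
have [dq Eq] := is_derive_line sq Us0.
have qpos : \forall s \near (0:R)^', 0 < s^-1 * q (s *: v + x).
  have := dq; rewrite /derivable => /cvg_ex[l ql].
  have lE : l = \sum_i v 0 i * pd i q x.
    by have := Eq; rewrite scale0r add0r => <-; apply/esym/cvg_lim.
  rewrite -lE in c0.
  have /cvgrPdist_lt /(_ _ c0) := ql.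
  apply: filterS => s /=; rewrite scale0r add0r q0 subr0 addr0 [s *: 1]mulr1.
  rewrite /GRing.scale /= ltr_norml => /andP[_].
  by rewrite ltrBlDr ltrDl.
have : \forall s \near (0:R), U (s *: v + x) /\ (s != 0 -> 0 < s^-1 * q (s *: v + x)).
  by near=> s; split; near: s.
move=> /nbhs_ballP[r /= r0 rP].
have rB s : 0 <= s <= r / 2 -> ball (0:R) r s.
  move=> /andP[s0 sr]; rewrite -ball_normE /= sub0r normrN ger0_norm//.
  by rewrite (le_lt_trans sr)// ltr_pdivrMr// ltr_pMr// ltr1n.
have r20 : 0 < r / 2 by rewrite divr_gt0.
have [s /andP[s0 sr]] := line_MVT sf r20 (fun s sr => (rP _ (rB s sr)).1).
rewrite -/(q _) => E.
have Ur : U ((r / 2) *: v + x) by apply: (rP _ (rB _ _)).1; rewrite lexx ltW.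
have : q (s *: v + x) * (r / 2) <= 0 by rewrite -E subr_le0 fmax.
rewrite leNgt => /negP; apply; rewrite mulr_gt0//.
have sB : ball (0:R) r s by apply: rB; rewrite !ltW.
have := (rP _ sB).2; rewrite gt_eqF// => /(_ isT).
by rewrite pmulr_rgt0// invr_gt0.
Unshelve. all: by end_near. Qed.

Lemma pd0_ball_cst f x (r : R) :
  smf (ball x r) f -> (forall i y, ball x r y -> pd i f y = 0) ->
  forall y, ball x r y -> f y = f x.
Proof.
move=> sf f0 y xy.
(* A ball is star-shaped about its centre, so the segment from x to y stays inside. *)
have inB s : 0 <= s <= 1 -> ball x r (s *: (y - x) + x).
  move=> /andP[s0 s1]; move: xy; rewrite -!ball_normE /=.
  apply: le_lt_trans; rewrite opprD addrCA subrr addr0 normrN normrZ.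
  by rewrite ger0_norm// distrC ler_piMl.
have [s /andP[s0 s1]] := line_MVT sf ltr01 inB.
rewrite scale1r subrK big1 ?mul0r => [/eqP|i _].
  by rewrite subr_eq0 => /eqP.
by rewrite f0 ?mulr0//; apply: inB; rewrite !ltW.
Qed.

End MeanValue.

(** * Matrix-valued functions *)

Lemma addmxE (R : pzRingType) p q (A B : 'M[R]_(p, q)) i j : (A + B) i j = A i j + B i j.
Proof. by rewrite mxE. Qed.

Lemma oppmxE (R : pzRingType) p q (A : 'M[R]_(p, q)) i j : (- A) i j = - A i j.
Proof. by rewrite mxE. Qed.

Lemma scalemxE (R : pzRingType) p q c (A : 'M[R]_(p, q)) i j : (c *: A) i j = c * A i j.
Proof. by rewrite mxE. Qed.

Lemma mulmxE (R : pzRingType) p q r (A : 'M[R]_(p, q)) (B : 'M[R]_(q, r)) i j :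
  (A *m B) i j = \sum_c A i c * B c j.
Proof. by rewrite mxE. Qed.

Lemma mxtraceN (R : pzRingType) p (A : 'M[R]_p) : \tr (- A) = - \tr A.
Proof. exact: (raddfN (@mxtrace R p)). Qed.

Lemma trmxD (R : pzRingType) p q (A B : 'M[R]_(p, q)) : (A + B)^T = A^T + B^T.
Proof. exact: linearD. Qed.

Lemma trmxN (R : pzRingType) p q (A : 'M[R]_(p, q)) : (- A)^T = - A^T.
Proof. exact: linearN. Qed.

(* Linear identities between matrices, products being treated as atoms. *)
Ltac mxring := apply/matrixP => ? ?; rewrite ?(addmxE, oppmxE, scalemxE); ring.

HB.lock Definition dm (R : realType) (n p q : nat) (i : 'I_n)
    (A : 'rV[R]_n -> 'M[R]_(p, q)) (x : 'rV[R]_n) : 'M[R]_(p, q) :=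
  \matrix_(a, b) pd i (fun y => A y a b) x.
Arguments dm {R n p q} i A x.

Section MatrixCalculus.
Context {R : realType} {n : nat}.
Implicit Types (U : set 'rV[R]_n) (i j k l : 'I_n) (x : 'rV[R]_n).

Definition smx {p q} U (A : 'rV[R]_n -> 'M[R]_(p, q)) : Prop :=
  forall a b, smf U (fun x => A x a b).

Lemma dmE {p q} i (A : 'rV[R]_n -> 'M[R]_(p, q)) x a b :
  dm i A x a b = pd i (fun y => A y a b) x.
Proof. by rewrite dm.unlock mxE. Qed.

Lemma smooth_on_smx {p q} U (A : 'rV[R]_n -> 'M[R]_(p, q)) :
  open U -> smooth_on U A -> smx U A.
Proof. by move=> oU sA a b; exact: smooth_on_entry. Qed.

Lemma dm_derive {p q} U (A : 'rV[R]_n -> 'M[R]_(p, q)) i x :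
  smooth_on U A -> U x -> 'D_(ebase R i) A x = dm i A x.
Proof.
move=> sA Ux; apply/matrixP => a b; rewrite dmE pdE derive_entry//.
by have [+ _] := sA 1%N; apply.
Qed.

Lemma smx_dm {p q} U (A : 'rV[R]_n -> 'M[R]_(p, q)) i : open U ->
  smx U A -> smx U (dm i A).
Proof.
by move=> oU sA a b; apply: smf_ext oU _ (smf_pd i (sA a b)) => x _; rewrite dmE.
Qed.

Lemma smx_ext {p q} U (A B : 'rV[R]_n -> 'M[R]_(p, q)) : open U ->
  (forall x, U x -> A x = B x) -> smx U A -> smx U B.
Proof. by move=> oU AB sA a b; apply: smf_ext oU _ (sA a b) => x /AB ->. Qed.

Lemma smxD {p q} U (A B : 'rV[R]_n -> 'M[R]_(p, q)) : open U ->
  smx U A -> smx U B -> smx U (fun x => A x + B x).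
Proof.
by move=> oU sA sB a b; apply: smf_ext oU _ (smfD oU (sA a b) (sB a b)) => x _; rewrite mxE.
Qed.

Lemma smxN {p q} U (A : 'rV[R]_n -> 'M[R]_(p, q)) : open U ->
  smx U A -> smx U (fun x => - A x).
Proof.
by move=> oU sA a b; apply: smf_ext oU _ (smfN oU (sA a b)) => x _; rewrite mxE.
Qed.

Lemma smxB {p q} U (A B : 'rV[R]_n -> 'M[R]_(p, q)) : open U ->
  smx U A -> smx U B -> smx U (fun x => A x - B x).
Proof. by move=> oU sA sB; apply: smxD => //; exact: smxN. Qed.

Lemma smxT {p q} U (A : 'rV[R]_n -> 'M[R]_(p, q)) : open U ->
  smx U A -> smx U (fun x => (A x)^T).
Proof. by move=> oU sA a b; apply: smf_ext oU _ (sA b a) => x _; rewrite mxE. Qed.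

Lemma smxM {p q r} U (A : 'rV[R]_n -> 'M[R]_(p, q)) (B : 'rV[R]_n -> 'M[R]_(q, r)) :
  open U -> smx U A -> smx U B -> smx U (fun x => A x *m B x).
Proof.
move=> oU sA sB a b.
apply: (smf_ext (f := fun x => \sum_c A x a c * B x c b) oU); first by move=> x _; rewrite mxE.
by apply: smf_sum => // c _; exact: smfM.
Qed.

Lemma smxZ {p q} U (f : 'rV[R]_n -> R) (A : 'rV[R]_n -> 'M[R]_(p, q)) : open U ->
  smf U f -> smx U A -> smx U (fun x => f x *: A x).
Proof.
by move=> oU sf sA a b; apply: smf_ext oU _ (smfM oU sf (sA a b)) => x _; rewrite mxE.
Qed.

Lemma smx_sum {p q} (I : Type) (r : seq I) (A : I -> 'rV[R]_n -> 'M[R]_(p, q)) U :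
  open U -> (forall c, smx U (A c)) -> smx U (fun x => \sum_(c <- r) A c x).
Proof.
move=> oU sA a b.
apply: smf_ext oU _ (smf_sum (P := xpredT) r oU (fun c _ => sA c a b)) => x _.
by rewrite summxE.
Qed.

Lemma smx_invmx {p} U (A : 'rV[R]_n -> 'M[R]_p) : open U ->
  (forall x, U x -> A x \in unitmx) -> smx U A -> smx U (fun x => invmx (A x)).
Proof. by move=> oU uA sA a b; exact: smf_invmx. Qed.

Lemma smf_tr {p} U (A : 'rV[R]_n -> 'M[R]_p) : open U ->
  smx U A -> smf U (fun x => \tr (A x)).
Proof. by move=> oU sA; apply: smf_sum. Qed.

Lemma dm_ext {p q} U (A B : 'rV[R]_n -> 'M[R]_(p, q)) i x : open U -> U x ->
  (forall y, U y -> A y = B y) -> dm i A x = dm i B x.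
Proof.
move=> oU Ux AB; apply/matrixP => a b; rewrite !dmE.
by apply: pd_ext oU Ux _ => y /AB ->.
Qed.

Lemma dm_cst {p q} (A : 'M[R]_(p, q)) i x : dm i (fun=> A) x = 0.
Proof. by apply/matrixP => a b; rewrite dmE pd_cst mxE. Qed.

Lemma dmD {p q} U (A B : 'rV[R]_n -> 'M[R]_(p, q)) i x : open U ->
  smx U A -> smx U B -> U x -> dm i (fun y => A y + B y) x = dm i A x + dm i B x.
Proof.
move=> oU sA sB Ux; apply/matrixP => a b; rewrite addmxE !dmE.
rewrite -(pdD (U := U)); [|exact: sA|exact: sB|by []].
by apply: pd_ext oU Ux _ => y _; rewrite mxE.
Qed.

Lemma dmN {p q} U (A : 'rV[R]_n -> 'M[R]_(p, q)) i x : open U ->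
  smx U A -> U x -> dm i (fun y => - A y) x = - dm i A x.
Proof.
move=> oU sA Ux; apply/matrixP => a b; rewrite oppmxE !dmE.
rewrite -(pdN (U := U)); [|exact: sA|by []].
by apply: pd_ext oU Ux _ => y _; rewrite mxE.
Qed.

Lemma dmB {p q} U (A B : 'rV[R]_n -> 'M[R]_(p, q)) i x : open U ->
  smx U A -> smx U B -> U x -> dm i (fun y => A y - B y) x = dm i A x - dm i B x.
Proof.
move=> oU sA sB Ux; rewrite -(dmN i oU sB Ux) -(dmD i oU sA (smxN oU sB) Ux).
by [].
Qed.

Lemma dmT {p q} (A : 'rV[R]_n -> 'M[R]_(p, q)) i x :
  dm i (fun y => (A y)^T) x = (dm i A x)^T.
Proof.
apply/matrixP => a b; rewrite [RHS]mxE !dmE; congr (pd i _ x).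
by apply/funext => y; rewrite mxE.
Qed.

Lemma dmM {p q r} U (A : 'rV[R]_n -> 'M[R]_(p, q)) (B : 'rV[R]_n -> 'M[R]_(q, r)) i x :
  open U -> smx U A -> smx U B -> U x ->
  dm i (fun y => A y *m B y) x = dm i A x *m B x + A x *m dm i B x.
Proof.
move=> oU sA sB Ux; apply/matrixP => a b; rewrite addmxE dmE !mxE -big_split /=.
transitivity (\sum_c pd i (fun y => A y a c * B y c b) x).
  rewrite -(pd_sum (U := U))//; last by move=> c _; exact: smfM.
  by apply: pd_ext oU Ux _ => y _; rewrite mxE.
apply: eq_bigr => c _; rewrite !dmE.
by rewrite (pdM i (sA a c) (sB c b) Ux).
Qed.

Lemma dmZ {p q} U (f : 'rV[R]_n -> R) (A : 'rV[R]_n -> 'M[R]_(p, q)) i x : open U ->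
  smf U f -> smx U A -> U x ->
  dm i (fun y => f y *: A y) x = pd i f x *: A x + f x *: dm i A x.
Proof.
move=> oU sf sA Ux; apply/matrixP => a b; rewrite addmxE !scalemxE !dmE.
rewrite -(pdM i sf (sA a b) Ux).
by apply: pd_ext oU Ux _ => y _; rewrite mxE.
Qed.

Lemma dm_sum {p q} (I : Type) (r : seq I) (A : I -> 'rV[R]_n -> 'M[R]_(p, q)) U i x :
  open U -> (forall c, smx U (A c)) -> U x ->
  dm i (fun x => \sum_(c <- r) A c x) x = \sum_(c <- r) dm i (A c) x.
Proof.
move=> oU sA Ux; apply/matrixP => a b; rewrite summxE dmE.
transitivity (pd i (fun x => \sum_(c <- r) A c x a b) x).
  by apply: pd_ext oU Ux _ => y _; rewrite summxE.
rewrite (pd_sum (U := U))//; last by move=> c _; exact: sA.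
by apply: eq_bigr => c _; rewrite dmE.
Qed.

Lemma pd_tr {p} U (A : 'rV[R]_n -> 'M[R]_p) i x : open U -> smx U A -> U x ->
  pd i (fun y => \tr (A y)) x = \tr (dm i A x).
Proof.
move=> oU sA Ux; rewrite /mxtrace (pd_sum (U := U))//.
by apply: eq_bigr => a _; rewrite dmE.
Qed.

Lemma dm_invmx {p} U (A : 'rV[R]_n -> 'M[R]_p) i x : open U ->
  (forall x, U x -> A x \in unitmx) -> smx U A -> U x ->
  dm i (fun y => invmx (A y)) x = - (invmx (A x) *m dm i A x *m invmx (A x)).
Proof.
move=> oU uA sA Ux; have sV := smx_invmx oU uA sA.
have : dm i (fun y => A y *m invmx (A y)) x = 0.
  rewrite -[RHS](dm_cst 1%:M i x); apply: dm_ext oU Ux _ => y /uA uy.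
  by rewrite mulmxV.
rewrite (dmM i oU sA sV Ux) => /(congr1 (mulmx (invmx (A x)))).
rewrite mulmx0 mulmxDr mulKmx ?uA// mulmxA => /eqP.
by rewrite addrC addr_eq0 => /eqP.
Qed.

Lemma dm_comm {p q} U (A : 'rV[R]_n -> 'M[R]_(p, q)) i j x : open U -> smx U A -> U x ->
  dm i (dm j A) x = dm j (dm i A) x.
Proof.
move=> oU sA Ux; apply/matrixP => a b; rewrite !dmE.
transitivity (pd i (pd j (fun y => A y a b)) x).
  by apply: pd_ext oU Ux _ => y _; rewrite dmE.
rewrite (clairaut i j oU (sA a b) Ux).
by apply: pd_ext oU Ux _ => y _; rewrite dmE.
Qed.

End MatrixCalculus.

Section MatrixChainRule.
Context {R : realType} {n m p q : nat}.
Variables (U : set 'rV[R]_n) (V : set 'rV[R]_m) (phi : 'rV[R]_n -> 'rV[R]_m).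
Hypotheses (oU : open U) (sphi : smooth_on U phi) (UV : forall x, U x -> V (phi x)).
Implicit Type A : 'rV[R]_m -> 'M[R]_(p, q).

Lemma smx_comp A : smx V A -> smx U (fun x => A (phi x)).
Proof. by move=> sA a b; exact: (smf_comp oU sphi UV (sA a b)). Qed.

Lemma dm_comp A i x : smx V A -> U x ->
  dm i (fun y => A (phi y)) x = \sum_c 'J phi x i c *: dm c A (phi x).
Proof.
move=> sA Ux; have dphi := smooth_on_differentiable sphi Ux.
apply/matrixP => a b; rewrite dmE summxE.
rewrite -[LHS]/(pd i ((fun z => A z a b) \o phi) x) pd_comp//; last first.
  by apply: smf_differentiable (sA a b) _; exact: UV.
by apply: eq_bigr => c _; rewrite scalemxE (jacobianE _ _ dphi) dmE mulrC.
Qed.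

End MatrixChainRule.

Section Jacobian.
Context {R : realType} {n m : nat}.
Variables (U : set 'rV[R]_n) (phi : 'rV[R]_n -> 'rV[R]_m).
Hypotheses (oU : open U) (sphi : smooth_on U phi).

Lemma smx_jacobian : smx U (fun x => 'J phi x).
Proof.
move=> i a; apply: smf_ext oU _ (smf_pd i (smooth_on_smf a oU sphi)) => x Ux.
by rewrite jacobianE//; exact: smooth_on_differentiable sphi Ux.
Qed.

Lemma dm_jacobian_sym i j a x : U x ->
  dm i (fun y => 'J phi y) x j a = dm j (fun y => 'J phi y) x i a.
Proof.
move=> Ux; rewrite !dmE.
have E k l : pd k (fun y => 'J phi y l a) x = pd k (pd l (fun y => phi y 0 a)) x.
  apply: pd_ext oU Ux _ => y Uy.
  by rewrite jacobianE//; exact: smooth_on_differentiable sphi Uy.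
by rewrite !E (clairaut i j oU (smooth_on_smf a oU sphi) Ux).
Qed.

Lemma derive2_jacobian i j a x : U x ->
  ('D_(ebase R i) ('D_(ebase R j) phi) x) 0 a = dm i (fun y => 'J phi y) x j a.
Proof.
move=> Ux; rewrite (derive_entry (A := 'D_(ebase R j) phi)); last first.
  by have [_ /(_ j)[+ _]] := sphi 2%N; apply.
transitivity (pd i (fun y => ('D_(ebase R j) phi y) 0 a) x); first by rewrite pdE.
rewrite dmE; apply: (pd_ext i oU Ux) => y Uy.
have dy := smooth_on_differentiable sphi Uy.
by rewrite (jacobianE _ _ dy) (derive_entry _ _ _ dy) pdE.
Qed.

End Jacobian.

(** * Levi-Civita connection and curvature in a chart *)

(** A metric on a bare open set: the local theory is applied both to full chart images and to the
    smaller domains where a map or a change of charts is defined. *)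
Record metric_on (R : realType) (n : nat) (U : set 'rV[R]_n)
    (G : 'rV[R]_n -> 'M[R]_n) : Prop := MetricOn {
  metric_on_open : open U ;
  metric_on_smooth : smooth_on U G ;
  metric_on_sym : forall x, U x -> (G x)^T = G x ;
  metric_on_pos : forall x (v : 'rV[R]_n), U x -> v != 0 ->
    0 < (v *m G x *m v^T) 0 0 }.

Section LocalMetric.
Context {R : realType} {n : nat}.
Variables (U : set 'rV[R]_n) (G : 'rV[R]_n -> 'M[R]_n).
Hypothesis mG : metric_on U G.
Implicit Types (i j k l : 'I_n) (x : 'rV[R]_n).

Let oU : open U := metric_on_open mG.

Lemma smx_metric : smx U G.
Proof. by apply: smooth_on_smx => //; exact: metric_on_smooth mG. Qed.

Lemma metric_unit x : U x -> G x \in unitmx.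
Proof.
move=> Ux; rewrite unitmxE unitfE; apply/negP => /det0P[v v0 vG].
by have := metric_on_pos mG Ux v0; rewrite vG mul0mx mxE ltxx.
Qed.

Lemma metricT x : U x -> (G x)^T = G x.
Proof. exact: (metric_on_sym mG). Qed.

Lemma smx_invmetric : smx U (fun x => invmx (G x)).
Proof. by apply: smx_invmx => //; [exact: metric_unit|exact: smx_metric]. Qed.

Lemma invmetricT x : U x -> (invmx (G x))^T = invmx (G x).
Proof. by move=> Ux; rewrite trmx_inv metricT. Qed.

(** Row i holds the components of nabla_k d_i. The matrix thus acts on components of vectors,
    written as rows, from the right, and with a minus sign on a covariant row index from the
    left. *)
Definition conn k x : 'M[R]_n := \matrix_(i, j) christoffel G j k i x.

Lemma connE k i j x : conn k x i j = christoffel G j k i x.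
Proof. by rewrite mxE. Qed.

Lemma christoffelE k i j x : U x -> christoffel G k i j x =
  2^-1 * \sum_l invmx (G x) k l * (dm i G x j l + dm j G x i l - dm l G x i j).
Proof.
move=> Ux; rewrite /christoffel; congr (_ * _); apply: eq_bigr => l _.
by rewrite !(dm_derive _ (metric_on_smooth mG) Ux).
Qed.

Lemma dm_metricT k x : U x -> (dm k G x)^T = dm k G x.
Proof. by move=> Ux; rewrite -dmT; apply: dm_ext oU Ux _ => y /metricT. Qed.

Lemma dm_metric_sym k i j x : U x -> dm k G x i j = dm k G x j i.
Proof. by move=> Ux; rewrite -{1}(dm_metricT k Ux) mxE. Qed.

Lemma christoffel_sym k i j x : U x -> christoffel G k i j x = christoffel G k j i x.
Proof.
move=> Ux; rewrite !christoffelE//; congr (_ * _); apply: eq_bigr => l _.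
by rewrite (dm_metric_sym l i j Ux) [dm i G x j l + _]addrC.
Qed.

Lemma conn_sym k i j x : U x -> conn k x i j = conn i x k j.
Proof. by move=> Ux; rewrite !mxE christoffel_sym. Qed.

Lemma smx_conn k : smx U (conn k).
Proof.
move=> i j.
apply: (smf_ext (f := fun x => 2^-1 *
   \sum_l invmx (G x) j l * (dm k G x i l + dm i G x k l - dm l G x k i)) oU).
  by move=> x Ux; rewrite mxE christoffelE.
have sdG l a b : smf U (fun x => dm l G x a b) by apply: smx_dm => //; exact: smx_metric.
apply: smfM => //; first exact: smf_cst.
apply: smf_sum => // l _; apply: smfM => //; first exact: smx_invmetric.
by apply: smfD => //; [exact: smfD|exact: smfN].
Qed.

(** The matrix C is twice the Christoffel symbols of the first kind. In C + C^T the last two terms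
    cancel by symmetry of G, leaving twice the derivative of G. *)
Lemma metric_compat k x : U x ->
  dm k G x = conn k x *m G x + G x *m (conn k x)^T.
Proof.
move=> Ux.
pose C : 'M[R]_n := \matrix_(i, l) (dm k G x i l + dm i G x k l - dm l G x k i).
have connG : conn k x *m G x = 2^-1 *: C.
  have -> : conn k x = 2^-1 *: (C *m invmx (G x)).
    apply/matrixP => i j; rewrite [LHS]mxE christoffelE// scalemxE; congr (_ * _).
    rewrite [RHS]mxE; apply: eq_bigr => l _; rewrite mulrC [C i l]mxE; congr (_ * _).
    by rewrite -[in LHS](invmetricT Ux) mxE.
  by rewrite -scalemxAl mulmxKV// metric_unit.
have -> : G x *m (conn k x)^T = (conn k x *m G x)^T by rewrite trmx_mul metricT.
rewrite connG; apply/matrixP => i j.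
rewrite addmxE [in X in _ + X]mxE !scalemxE [C i j]mxE [C j i]mxE.
rewrite (dm_metric_sym k j i Ux) (dm_metric_sym i k j Ux) (dm_metric_sym j k i Ux).
by field.
Qed.

(* R(d_l, d_i), acting on row vectors. *)
Definition curv l i x : 'M[R]_n := \matrix_(k, p) riemann_coef G p k l i x.

(** The products come in the reverse of the usual order because the matrices act on rows from the
    right. *)
Lemma curvE l i x : U x -> curv l i x =
  dm l (conn i) x - dm i (conn l) x + conn i x *m conn l x - conn l x *m conn i x.
Proof.
move=> Ux; apply/matrixP => k p.
rewrite [LHS]mxE /riemann_coef.
have E a b : 'D_(ebase R a) (christoffel G p b k : _ -> R^o) x = dm a (conn b) x k p.
  transitivity (pd a (christoffel G p b k) x); first by rewrite pdE.
  by rewrite dmE; apply: pd_ext oU Ux _ => y _; rewrite mxE.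
have S a b : (conn a x *m conn b x) k p =
    \sum_h christoffel G p b h x * christoffel G h a k x.
  by rewrite mxE; apply: eq_bigr => h _; rewrite /conn !mxE mulrC.
by rewrite !E sumrB -!S !addmxE !oppmxE addrA.
Qed.

Lemma curv_anti l i x : U x -> curv l i x = - curv i l x.
Proof. by move=> Ux; rewrite !curvE//; mxring. Qed.

(** Second derivatives of G commute. Computing both orders by differentiating [metric_compat] once
    more leaves exactly the symmetric part of [curv l i x *m G x], which therefore vanishes. *)
Lemma curv_metric_anti l i x : U x ->
  (curv l i x *m G x)^T = - (curv l i x *m G x).
Proof.
move=> Ux.
have sG := smx_metric; have sc := smx_conn.
have ddG a b : dm a (dm b G) x = dm a (conn b) x *m G x + conn b x *m dm a G x
    + (dm a G x *m (conn b x)^T + G x *m (dm a (conn b) x)^T).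
  transitivity (dm a (fun y => conn b y *m G y + G y *m (conn b y)^T) x).
    by apply: dm_ext oU Ux _ => y; exact: metric_compat.
  rewrite (dmD a oU (smxM oU (sc b) sG) (smxM oU sG (smxT oU (sc b))) Ux).
  by rewrite (dmM a oU (sc b) sG Ux) (dmM a oU sG (smxT oU (sc b)) Ux) dmT.
have /eqP := dm_comm l i oU sG Ux.
rewrite !ddG -subr_eq0 !(metric_compat _ Ux) => /eqP E.
apply/eqP; rewrite -addr_eq0; apply/eqP; rewrite -E curvE//.
rewrite trmx_mul metricT//.
move: (dm l _ x) (dm i _ x) (conn i x) (conn l x) (G x) => dA dB A B g.
rewrite !(trmxD, trmxN) !trmx_mul !(mulmxDl, mulmxDr, mulNmx, mulmxN) !mulmxA.
mxring.
Qed.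

End LocalMetric.

(** * The pulled-back connection of a map *)

Section LocalMap.
Context {R : realType} {n m : nat}.
Variables (U : set 'rV[R]_n) (G : 'rV[R]_n -> 'M[R]_n).
Variables (V : set 'rV[R]_m) (H : 'rV[R]_m -> 'M[R]_m) (F : 'rV[R]_n -> 'rV[R]_m).
Hypotheses (mG : metric_on U G) (mH : metric_on V H).
Hypotheses (sF : smooth_on U F) (UV : forall x, U x -> V (F x)).
Implicit Types (i j k l : 'I_n) (a b c : 'I_m) (x : 'rV[R]_n).
Implicit Types (X Y : 'rV[R]_n -> 'M[R]_(n, m)).

Let oU : open U := metric_on_open mG.
Let E x := 'J F x.
Let sE : smx U E := smx_jacobian oU sF.

(* The pull-back by F of the Levi-Civita connection of H. *)
Definition pbconn k x : 'M[R]_m := \sum_c 'J F x k c *: conn H c (F x).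

(* Covariant derivative of a section of T*M (x) F*TN, the index k being kept
   as a mere parameter. *)
Definition covd k X x : 'M[R]_(n, m) :=
  dm k X x - conn G k x *m X x + X x *m pbconn k x.

Definition pbcurv l k x : 'M[R]_m :=
  \sum_b \sum_c ('J F x l b * 'J F x k c) *: curv H b c (F x).

Lemma smx_pbconn k : smx U (pbconn k).
Proof.
apply: smx_sum => // c; apply: smxZ => //.
exact: (smx_comp oU sF UV (smx_conn mH c)).
Qed.

Lemma smx_covd k X : smx U X -> smx U (covd k X).
Proof.
move=> sX; apply: smxD => //; last by apply: smxM => //; exact: smx_pbconn.
apply: smxB => //; first exact: smx_dm.
by apply: smxM => //; exact: (smx_conn mG).
Qed.

Lemma smx_pbmetric : smx U (fun y => H (F y)).
Proof. exact: (smx_comp oU sF UV (smx_metric mH)). Qed.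

Lemma pbmetricT x : U x -> (H (F x))^T = H (F x).
Proof. by move=> Ux; apply: (metricT mH); exact: UV. Qed.

Lemma pbmetric_compat k x : U x ->
  dm k (fun y => H (F y)) x = pbconn k x *m H (F x) + H (F x) *m (pbconn k x)^T.
Proof.
move=> Ux; rewrite (dm_comp sF UV k (smx_metric mH) Ux).
rewrite /pbconn mulmx_suml (raddf_sum trmx) mulmx_sumr -big_split /=.
apply: eq_bigr => c _; rewrite (metric_compat mH c (UV Ux)).
by rewrite linearZ /= -scalemxAl -scalemxAr -scalerDr.
Qed.

(** Symmetry of the second fundamental form: second derivatives of F commute and both connections
    are torsion-free. *)
Lemma covd_jacobian_sym k i a x : U x ->
  covd k (fun y => 'J F y) x i a = covd i (fun y => 'J F y) x k a.
Proof.
move=> Ux; rewrite /covd !addmxE !oppmxE (dm_jacobian_sym oU sF) //.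
congr (_ - _ + _).
  by rewrite !mulmxE; apply: eq_bigr => j _; rewrite (conn_sym mG).
rewrite /pbconn !mulmx_sumr !summxE.
under eq_bigr => c _ do rewrite -scalemxAr scalemxE mulmxE mulr_sumr.
under [RHS]eq_bigr => c _ do rewrite -scalemxAr scalemxE mulmxE mulr_sumr.
rewrite exchange_big; apply: eq_bigr => c _; apply: eq_bigr => b _ /=.
by rewrite (conn_sym mH b c a (UV Ux)) mulrCA.
Qed.

(** The curvature of the pulled-back connection is the pull-back of the curvature: the terms
    containing second derivatives of F are symmetric in l and k and cancel. *)
Lemma pbcurvE l k x : U x -> pbcurv l k x =
  dm l (pbconn k) x - dm k (pbconn l) x
  + pbconn k x *m pbconn l x - pbconn l x *m pbconn k x.
Proof.
move=> Ux; have Vx := UV Ux.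
have dE p q : dm p (pbconn q) x = (\sum_c dm p E x q c *: conn H c (F x))
    + \sum_b \sum_c (E x p b * E x q c) *: dm b (conn H c) (F x).
  rewrite /pbconn (dm_sum _ _ oU _ Ux); last first.
    move=> c; apply: smxZ => //.
    exact: (smx_comp oU sF UV (smx_conn mH c)).
  rewrite [X in _ = _ + X]exchange_big -big_split; apply: eq_bigr => c _ /=.
  have sc := smx_comp oU sF UV (smx_conn mH c).
  rewrite (dmZ p oU (sE q c) sc Ux) dmE; congr (_ + _).
  rewrite (dm_comp sF UV p (smx_conn mH c) Ux) scaler_sumr.
  by apply: eq_bigr => b _; rewrite scalerA mulrC.
have mE p q : pbconn p x *m pbconn q x =
    \sum_b \sum_c (E x p b * E x q c) *: (conn H b (F x) *m conn H c (F x)).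
  rewrite /pbconn mulmx_suml; apply: eq_bigr => b _; rewrite mulmx_sumr.
  by apply: eq_bigr => c _; rewrite -scalemxAl -scalemxAr scalerA.
have sw (T : 'I_m -> 'I_m -> 'M[R]_m) p q :
    \sum_b \sum_c (E x p b * E x q c) *: T b c =
    \sum_b \sum_c (E x q b * E x p c) *: T c b.
  rewrite exchange_big; apply: eq_bigr => b _; apply: eq_bigr => c _ /=.
  by rewrite [_ * E x q b]mulrC.
(* [sw] gives all double sums the common coefficient E_lb E_kc, so that their summands assemble into
   [curv H b c]. *)
rewrite !dE !mE [X in _ - (_ + X)]sw [X in _ + X - _]sw.
have -> : \sum_c dm k E x l c *: conn H c (F x) =
    \sum_c dm l E x k c *: conn H c (F x).
  by apply: eq_bigr => c _; rewrite (dm_jacobian_sym oU sF).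
rewrite opprD addrACA subrr add0r -!sumrB -big_split -sumrB /=.
apply: eq_bigr => b _; rewrite -!sumrB -big_split -sumrB /=.
apply: eq_bigr => c _; rewrite -!scalerBr -scalerDr -scalerBr.
by rewrite (curvE mH _ _ Vx).
Qed.

(** The Ricci identity for sections of T*M (x) F*TN. No Christoffel term appears for k and l, which
    are parameters of commuting coordinate fields. *)
Lemma covd_comm l k X x : smx U X -> U x ->
  covd l (covd k X) x - covd k (covd l X) x =
  - (curv G l k x *m X x) + X x *m pbcurv l k x.
Proof.
move=> sX Ux.
have sc := smx_conn mG; have sb := smx_pbconn.
have dcovd p q : dm p (covd q X) x = dm p (dm q X) x
    - (dm p (conn G q) x *m X x + conn G q x *m dm p X x)
    + (dm p X x *m pbconn q x + X x *m dm p (pbconn q) x).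
  have s1 := smxM oU (sc q) sX; have s2 := smxM oU sX (sb q).
  rewrite (dmD p oU (smxB oU (smx_dm q oU sX) s1) s2 Ux).
  rewrite (dmB p oU (smx_dm q oU sX) s1 Ux).
  by rewrite (dmM p oU (sc q) sX Ux) (dmM p oU sX (sb q) Ux).
rewrite /covd -/(covd k X) -/(covd l X) !dcovd (dm_comm l k oU sX Ux).
rewrite (curvE mG _ _ Ux) (pbcurvE _ _ Ux) /covd.
move: (dm k (dm l X) x) (dm l X x) (dm k X x) (X x) => ddX dlX dkX X0.
move: (dm l (pbconn k) x) (dm k (pbconn l) x) (pbconn k x) (pbconn l x) => dB dB' B B'.
move: (dm l (conn G k) x) (dm k (conn G l) x) (conn G k x) (conn G l x) => dA dA' A A'.
rewrite !(mulmxDl, mulmxDr, mulNmx, mulmxN) !mulmxA.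
mxring.
Qed.

Lemma dm_pairing k X Y x : smx U X -> smx U Y -> U x ->
  dm k (fun y => X y *m H (F y) *m (Y y)^T) x =
  covd k X x *m H (F x) *m (Y x)^T + X x *m H (F x) *m (covd k Y x)^T
  + conn G k x *m (X x *m H (F x) *m (Y x)^T)
  + (X x *m H (F x) *m (Y x)^T) *m (conn G k x)^T.
Proof.
move=> sX sY Ux; have sH := smx_pbmetric.
rewrite (dmM k oU (smxM oU sX sH) (smxT oU sY) Ux) (dmM k oU sX sH Ux) dmT.
rewrite (pbmetric_compat _ Ux) /covd.
move: (dm k X x) (dm k Y x) (X x) (Y x) (H (F x)) (conn G k x) (pbconn k x).
move=> dX dY X0 Y0 h A B.
rewrite !(trmxD, trmxN) !trmx_mul !(mulmxDl, mulmxDr, mulNmx, mulmxN) !mulmxA.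
mxring.
Qed.

(** The terms in [conn G k] left over by [dm_pairing] belong to the row indices of X and Y. Once
    these are contracted, they cancel against the derivative of the inverse metric, by metric
    compatibility. *)
Lemma pd_tr_pairing k X Y x : smx U X -> smx U Y -> U x ->
  pd k (fun y => \tr (invmx (G y) *m (X y *m H (F y) *m (Y y)^T))) x =
  \tr (invmx (G x) *m (covd k X x *m H (F x) *m (Y x)^T
                       + X x *m H (F x) *m (covd k Y x)^T)).
Proof.
move=> sX sY Ux; have sH := smx_pbmetric; have sV := smx_invmetric mG.
have sP := smxM oU (smxM oU sX sH) (smxT oU sY).
rewrite (pd_tr k oU (smxM oU sV sP) Ux) (dmM k oU sV sP Ux).
rewrite (dm_invmx k oU (metric_unit mG) (smx_metric mG) Ux).
rewrite (dm_pairing k sX sY Ux) (metric_compat mG k Ux).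
have uG := metric_unit mG Ux.
move: (X x *m H (F x) *m (Y x)^T) (covd k X x *m H (F x) *m (Y x)^T).
move: (X x *m H (F x) *m (covd k Y x)^T) (conn G k x) => D2 A P D1.
set g := invmx (G x).
have -> : g *m (A *m G x + G x *m A^T) *m g = g *m A + A^T *m g.
  by rewrite mulmxDr mulmxDl !mulmxA mulmxK// mulVmx// mul1mx.
rewrite !(mulmxDl, mulmxDr, mulNmx) !(mxtraceD, mxtraceN) !mulmxA.
have -> : \tr (A^T *m g *m P) = \tr (g *m P *m A^T).
  by rewrite -mulmxA mxtrace_mulC.
ring.
Qed.

Lemma tension_locE a x : U x -> tension_loc G H F x 0 a =
  \sum_i \sum_j invmx (G x) i j * covd i (fun y => 'J F y) x j a.
Proof.
move=> Ux; rewrite [LHS]mxE; apply: eq_bigr => i _; apply: eq_bigr => j _.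
congr (_ * _); rewrite /nabla_d (derive2_jacobian oU sF)// /covd !addmxE oppmxE.
congr (_ - _ + _).
  by rewrite mulmxE; apply: eq_bigr => k _; rewrite connE.
rewrite mulmxE exchange_big /=; apply: eq_bigr => c _.
rewrite /pbconn summxE mulr_sumr; apply: eq_bigr => b _.
by rewrite scalemxE connE; ring.
Qed.

End LocalMap.

(** * Algebra of the curvature operator and of sectional curvature *)

Section CurvatureOperator.
Context {R : realType} {n : nat}.
Variable G : 'rV[R]_n -> 'M[R]_n.
Implicit Types (i j k l : 'I_n) (x X Y Z W : 'rV[R]_n).

Definition curv_op x X Y : 'M[R]_n :=
  \sum_i \sum_j (X 0 i * Y 0 j) *: curv G i j x.

Lemma riemannE x X Y Z : riemann G x X Y Z = Z *m curv_op x X Y.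
Proof.
apply/rowP => l; rewrite [LHS]mxE /curv_op mulmx_sumr summxE; apply: eq_bigr => i _.
rewrite mulmx_sumr summxE; apply: eq_bigr => j _.
rewrite -scalemxAr scalemxE mulmxE mulr_sumr; apply: eq_bigr => k _.
by rewrite /curv [X in _ * (_ * X)]mxE mulrA.
Qed.

Lemma curv_opDl x X X' Y : curv_op x (X + X') Y = curv_op x X Y + curv_op x X' Y.
Proof.
rewrite /curv_op -big_split; apply: eq_bigr => i _ /=.
rewrite -big_split; apply: eq_bigr => j _ /=.
by rewrite addmxE mulrDl scalerDl.
Qed.

Lemma curv_opZl x c X Y : curv_op x (c *: X) Y = c *: curv_op x X Y.
Proof.
rewrite /curv_op scaler_sumr; apply: eq_bigr => i _ /=.
rewrite scaler_sumr; apply: eq_bigr => j _ /=.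
by rewrite scalemxE scalerA mulrA.
Qed.

Lemma ricciE x Y Z : ricci G x Y Z =
  \sum_j \sum_k Y 0 j * Z 0 k * \sum_i curv G i j x k i.
Proof.
rewrite /ricci.
under eq_bigr => i _.
  rewrite riemannE mulmxE.
  under eq_bigr => k _.
    rewrite /curv_op summxE (bigD1 i)//= [X in _ + X]big1 => [|l li]; last first.
      by rewrite summxE big1// => j _; rewrite mxE mxE eqxx (negbTE li) !mul0r.
    rewrite addr0 summxE mulr_sumr.
    under eq_bigr => j _ do rewrite mxE [X in X * Y 0 j]mxE !eqxx mul1r.
    over.
  rewrite exchange_big /=.
  over.
rewrite exchange_big; apply: eq_bigr => j _ /=.
rewrite exchange_big; apply: eq_bigr => k _ /=.
by rewrite mulr_sumr; apply: eq_bigr => i _; ring.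
Qed.

Lemma innerDl x X Y Z : inner G x (X + Y) Z = inner G x X Z + inner G x Y Z.
Proof. by rewrite /inner !mulmxDl mxE. Qed.

Lemma innerZl x c X Z : inner G x (c *: X) Z = c * inner G x X Z.
Proof. by rewrite /inner -!scalemxAl mxE. Qed.

Lemma innerDr x X Y Z : inner G x Z (X + Y) = inner G x Z X + inner G x Z Y.
Proof. by rewrite /inner trmxD mulmxDr mxE. Qed.

Lemma innerZr x c X Z : inner G x Z (c *: X) = c * inner G x Z X.
Proof. by rewrite /inner linearZ /= -scalemxAr mxE. Qed.

Lemma inner0l x Z : inner G x 0 Z = 0.
Proof. by rewrite /inner !mul0mx mxE. Qed.

Variable U : set 'rV[R]_n.
Hypothesis mG : metric_on U G.

Lemma innerC x X Y : U x -> inner G x X Y = inner G x Y X.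
Proof.
move=> Ux; rewrite /inner -[in LHS](trmxK (X *m _ *m _)) [LHS]mxE.
by rewrite !trmx_mul trmxK (metricT mG Ux) mulmxA.
Qed.

Lemma inner_ge0 x X : U x -> 0 <= inner G x X X.
Proof.
move=> Ux; have [->|X0] := eqVneq X 0; first by rewrite inner0l.
exact/ltW/(metric_on_pos mG Ux X0).
Qed.

Lemma inner_gt0 x X : U x -> X != 0 -> 0 < inner G x X X.
Proof. by move=> Ux X0; exact: (metric_on_pos mG). Qed.

Lemma curv_op_anti x X Y : U x -> curv_op x X Y = - curv_op x Y X.
Proof.
move=> Ux; rewrite /curv_op exchange_big -sumrN; apply: eq_bigr => i _ /=.
rewrite -sumrN; apply: eq_bigr => j _.
by rewrite (curv_anti mG _ _ Ux) scalerN mulrC.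
Qed.

Lemma curv_opXX x X : U x -> curv_op x X X = 0.
Proof.
move=> Ux; have := curv_op_anti X X Ux => /eqP; rewrite -addr_eq0 -mulr2n => /eqP E.
apply/matrixP => i j; have := congr1 (fun A : 'M[R]_n => A i j) E.
by rewrite mulr2n addmxE mxE => ?; lra.
Qed.

Lemma inner_curv_op x X Y Z : U x -> inner G x (Z *m curv_op x X Y) Z = 0.
Proof.
move=> Ux.
have T : (curv_op x X Y *m G x)^T = - (curv_op x X Y *m G x).
  rewrite /curv_op mulmx_suml (raddf_sum trmx) -sumrN; apply: eq_bigr => i _ /=.
  rewrite mulmx_suml (raddf_sum trmx) -sumrN; apply: eq_bigr => j _ /=.
  by rewrite -scalemxAl linearZ /= (curv_metric_anti mG _ _ Ux) scalerN.
set A := Z *m (curv_op x X Y *m G x) *m Z^T.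
have AT : A^T = - A by rewrite /A trmx_mul trmxK trmx_mul T mulNmx mulmxN mulmxA.
have -> : inner G x (Z *m curv_op x X Y) Z = A 0 0 by rewrite /inner /A !mulmxA.
have := congr1 (fun B : 'M[R]_1 => B 0 0) AT; rewrite mxE oppmxE => ?; lra.
Qed.

(** Numerator and denominator of [sectional] are kept apart so that curvature bounds, in the form
    numerator <= constant * denominator, also cover linearly dependent pairs. *)
Definition sec_num x X Y := inner G x (riemann G x X Y Y) X.

Definition sec_den x X Y := inner G x X X * inner G x Y Y - inner G x X Y ^+ 2.

Lemma sec_num0l x Y : sec_num x 0 Y = 0.
Proof. by rewrite /sec_num /inner trmx0 mulmx0 mxE. Qed.

Lemma sec_num_shift x X Y c : U x -> sec_num x X (Y + c *: X) = sec_num x X Y.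
Proof.
move=> Ux; rewrite /sec_num !riemannE.
have -> : curv_op x X (Y + c *: X) = curv_op x X Y.
  rewrite !(curv_op_anti X _ Ux) curv_opDl curv_opZl.
  by rewrite curv_opXX// scaler0 addr0.
by rewrite mulmxDl -scalemxAl innerDl innerZl inner_curv_op// mulr0 addr0.
Qed.

Lemma sec_den_shift x X Y c : U x -> sec_den x X (Y + c *: X) = sec_den x X Y.
Proof.
move=> Ux; rewrite /sec_den !(innerDl, innerDr, innerZl, innerZr).
by rewrite (innerC Y X Ux); ring.
Qed.

(** Shears leave numerator and denominator unchanged, so Y may be made orthogonal to X; the
    denominator is then a product of squared norms. *)
Lemma sec_gram_schmidt x X Y : U x -> X != 0 ->
  exists Z, [/\ sec_num x X Z = sec_num x X Y, sec_den x X Z = sec_den x X Y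
   & inner G x X Z = 0].
Proof.
move=> Ux X0; have XX := inner_gt0 Ux X0.
exists (Y + (- (inner G x X Y / inner G x X X)) *: X).
split; [exact: sec_num_shift|exact: sec_den_shift|].
by rewrite innerDr innerZr mulNr divfK ?subrr// gt_eqF.
Qed.

Lemma sec_num_not_free x X Y : U x -> ~~ free [:: X; Y] -> sec_num x X Y = 0.
Proof.
move=> Ux; rewrite free_cons /= free_cons nil_free andbT span_nil span_seq1 negb_and.
have [->|X0] := eqVneq X 0; first by rewrite sec_num0l.
rewrite memv0 !negbK => /orP[/vlineP[c XcY]|/eqP->].
  by rewrite /sec_num riemannE XcY curv_opZl curv_opXX// scaler0 mulmx0 inner0l.
by rewrite /sec_num riemannE mul0mx inner0l.
Qed.

Lemma sec_den_ge0 x X Y : U x -> 0 <= sec_den x X Y.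
Proof.
move=> Ux; have [->|X0] := eqVneq X 0.
  by rewrite /sec_den !inner0l mul0r expr0n subrr.
have [Z [_ <- XZ]] := sec_gram_schmidt Y Ux X0.
by rewrite /sec_den XZ expr0n subr0 mulr_ge0// inner_ge0.
Qed.

Lemma sec_den_gt0 x X Y : U x -> free [:: X; Y] -> 0 < sec_den x X Y.
Proof.
move=> Ux fXY; move: (fXY); rewrite free_cons /= => /andP[XY].
rewrite free_cons span_nil memv0 => /andP[Y0 _].
have X0 : X != 0 by apply: contra XY => /eqP ->; exact: mem0v.
have XX := inner_gt0 Ux X0.
rewrite -(sec_den_shift X Y (- (inner G x X Y / inner G x X X)) Ux).
have XW : inner G x X (Y + (- (inner G x X Y / inner G x X X)) *: X) = 0.
  by rewrite innerDr innerZr mulNr divfK ?subrr// gt_eqF.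
rewrite /sec_den XW expr0n subr0.
apply: mulr_gt0 => //; apply: inner_gt0 => //; apply: contra XY.
rewrite addr_eq0; set c := _ / _ => /eqP YX.
have c0 : c != 0.
  by apply: contra Y0 => /eqP c0; rewrite YX c0 oppr0 scale0r oppr0.
rewrite span_seq1; apply/vlineP; exists c^-1.
by rewrite YX scaleNr opprK scalerA mulVf// scale1r.
Qed.

End CurvatureOperator.

Lemma curv_op_mul (R : realType) n m (H : 'rV[R]_m -> 'M[R]_m)
    (F : 'rV[R]_n -> 'rV[R]_m) (x X Y : 'rV[R]_n) :
  curv_op H (F x) (X *m 'J F x) (Y *m 'J F x) =
  \sum_i \sum_j (X 0 i * Y 0 j) *: pbcurv H F i j x.
Proof.
rewrite /pbcurv /curv_op; set J := 'J F x.
symmetry; transitivity (\sum_i \sum_j \sum_b \sum_c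
    ((X 0 i * Y 0 j) * (J i b * J j c)) *: curv H b c (F x)).
  apply: eq_bigr => i _; apply: eq_bigr => j _; rewrite scaler_sumr.
  apply: eq_bigr => b _; rewrite scaler_sumr.
  by apply: eq_bigr => c _; rewrite scalerA.
transitivity (\sum_i \sum_b \sum_j \sum_c
    ((X 0 i * Y 0 j) * (J i b * J j c)) *: curv H b c (F x)).
  by apply: eq_bigr => i _; rewrite exchange_big.
rewrite exchange_big; apply: eq_bigr => b _ /=.
transitivity (\sum_i \sum_c \sum_j
    ((X 0 i * Y 0 j) * (J i b * J j c)) *: curv H b c (F x)).
  by apply: eq_bigr => i _; rewrite exchange_big.
rewrite exchange_big; apply: eq_bigr => c _ /=.
rewrite !mulmxE mulr_suml scaler_suml; apply: eq_bigr => i _.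
rewrite mulr_sumr scaler_suml; apply: eq_bigr => j _.
by rewrite mulrACA.
Qed.

(** * A smooth bound for the sectional curvatures at a point *)

Section SectionalBound.
Context {R : realType} {n : nat}.
Variables (U : set 'rV[R]_n) (G : 'rV[R]_n -> 'M[R]_n).
Hypothesis mG : metric_on U G.
Implicit Types (i j k l : 'I_n) (x X Y : 'rV[R]_n).

Let oU : open U := metric_on_open mG.

Lemma smx_curv l i : smx U (curv G l i).
Proof.
have sc := smx_conn mG.
apply: (smx_ext oU (A := fun x => dm l (conn G i) x - dm i (conn G l) x
  + conn G i x *m conn G l x - conn G l x *m conn G i x)).
  by move=> x Ux; rewrite (curvE mG).
by apply: smxB => //; [apply: smxD => //; [apply: smxB => //; exact: smx_dm|]|];
   exact: smxM.
Qed.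

(** Cauchy-Schwarz against W, the gradient of the i-th coordinate: <X, W> = X_i and |W|^2 is the
    i-th diagonal entry of the inverse metric. *)
Lemma coord_sqr_le x X i : U x ->
  X 0 i ^+ 2 <= invmx (G x) i i * inner G x X X.
Proof.
move=> Ux; have uG := metric_unit mG Ux.
pose W := ebase R i *m invmx (G x).
have XW : inner G x X W = X 0 i.
  rewrite /inner /W trmx_mul (invmetricT mG Ux) mulmxA mulmxK// mulmxE.
  rewrite (bigD1 i)//= big1 ?addr0 => [|k ki].
    by rewrite /ebase !mxE !eqxx mulr1.
  by rewrite /ebase !mxE (negbTE ki) andbF mulr0.
have WW : inner G x W W = invmx (G x) i i.
  rewrite /inner /W trmx_mul (invmetricT mG Ux) mulmxKV// mulmxA -rowE.
  rewrite mulmxE (bigD1 i)//= big1 ?addr0 => [|k ki].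
    by rewrite /ebase [X in _ * X]mxE [X in _ * X]mxE !eqxx mulr1 mxE.
  by rewrite /ebase [X in _ * X]mxE [X in _ * X]mxE (negbTE ki) andbF mulr0.
have := sec_den_ge0 mG W X Ux.
by rewrite /sec_den WW (innerC mG W X Ux) XW subr_ge0.
Qed.

(* 1 + c^2 instead of |c| keeps the bound smooth in x. *)
Definition sec_bound x : R :=
  (\sum_i \sum_j \sum_k \sum_p (1 + (curv G i j x *m G x) k p ^+ 2))
  * \tr (invmx (G x)) ^+ 2.

Lemma smf_sec_bound : smf U sec_bound.
Proof.
have s1 : smf U (fun x => \tr (invmx (G x))).
  by apply: smf_tr => //; exact: (smx_invmetric mG).
apply: smfM => //; last exact: (smfM oU s1 s1).
do 4!(apply: smf_sum => // ? _); apply: smfD => //; first exact: smf_cst.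
have s2 a b : smx U (fun x => curv G a b x *m G x).
  by apply: smxM => //; [exact: smx_curv|exact: (smx_metric mG)].
by apply: (smfM oU); exact: s2.
Qed.

(** Expand in coordinates and estimate term by term: a product of two coordinates of Z is at most
    [D] times |Z|^2 in absolute value. The squared trace in [sec_bound] comes from using this for X
    and for Y. *)
Lemma sec_num_le_sqr x X Y : U x ->
  sec_num G x X Y <= sec_bound x * (inner G x X X * inner G x Y Y).
Proof.
move=> Ux; set D := \tr (invmx (G x)).
(* For X = e_i, [coord_sqr_le] reads 1 <= g^ii |e_i|^2, which excludes a negative g^ii. *)
have g0 i : 0 <= invmx (G x) i i.
  have := coord_sqr_le (ebase R i) i Ux; rewrite mxE !eqxx expr1n => h.
  rewrite leNgt; apply/negP => h'; move: h; rewrite leNgt => /negP; apply.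
  by rewrite (le_lt_trans _ ltr01)// mulr_le0_ge0 ?(ltW h')// (inner_ge0 mG).
have D0 i : invmx (G x) i i <= D.
  by rewrite /D /mxtrace (bigD1 i)//= lerDl sumr_ge0.
have prod_le (Z : 'rV[R]_n) i j : `|Z 0 i * Z 0 j| <= D * inner G x Z Z.
  have Z0 := inner_ge0 mG Z Ux.
  have a i' : Z 0 i' ^+ 2 <= D * inner G x Z Z.
    by apply: le_trans (coord_sqr_le Z i' Ux) _; rewrite ler_wpM2r.
  have := a i; have := a j; rewrite ler_norml.
  have := sqr_ge0 (Z 0 i + Z 0 j); have := sqr_ge0 (Z 0 i - Z 0 j).
  rewrite sqrrB sqrrD !mulr2n => h1 h2 h3 h4; apply/andP; split; lra.
have -> : sec_num G x X Y = \sum_i \sum_j \sum_k \sum_p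
    (X 0 i * X 0 p) * (Y 0 j * Y 0 k) * (curv G i j x *m G x) k p.
  rewrite /sec_num /inner riemannE /curv_op mulmx_sumr !mulmx_suml summxE.
  apply: eq_bigr => i _; rewrite mulmx_sumr !mulmx_suml summxE.
  apply: eq_bigr => j _; rewrite -scalemxAr -!scalemxAl scalemxE -(mulmxA Y).
  rewrite mulmxE mulr_sumr exchange_big; apply: eq_bigr => p _ /=.
  rewrite mulmxE mulr_suml mulr_sumr; apply: eq_bigr => k _.
  by rewrite [X^T _ _]mxE; ring.
rewrite /sec_bound !mulr_suml; apply: ler_sum => i _.
rewrite !mulr_suml; apply: ler_sum => j _.
rewrite !mulr_suml; apply: ler_sum => k _.
rewrite !mulr_suml; apply: ler_sum => p _.
set c := (_ *m _) k p.
have c1 : `|c| <= 1 + c ^+ 2.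
  rewrite ler_norml; have := sqr_ge0 (c - 1); have := sqr_ge0 (c + 1).
  by have := sqr_ge0 c; rewrite !expr2 => *; apply/andP; split; nra.
apply: le_trans (ler_norm _) _; rewrite normrM [X in X * _ <= _]normrM -/D.
have -> : (1 + c ^+ 2) * D ^+ 2 * (inner G x X X * inner G x Y Y) =
  (D * inner G x X X) * (D * inner G x Y Y) * (1 + c ^+ 2) by ring.
by apply: ler_pM; rewrite ?mulr_ge0//; exact: ler_pM.
Qed.

Lemma sec_bound_ge0 x : 0 <= sec_bound x.
Proof.
apply: mulr_ge0; last exact: sqr_ge0.
by do 4!(apply: sumr_ge0 => ? _); rewrite addr_ge0// sqr_ge0.
Qed.

Lemma sec_num_le x X Y : U x -> sec_num G x X Y <= sec_bound x * sec_den G x X Y.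
Proof.
move=> Ux; have [->|X0] := eqVneq X 0.
  by rewrite sec_num0l mulr_ge0 ?sec_bound_ge0// (sec_den_ge0 mG).
have [Z [<- <- XZ]] := sec_gram_schmidt mG Y Ux X0.
by apply: le_trans (sec_num_le_sqr X Z Ux) _; rewrite /sec_den XZ expr0n subr0.
Qed.

End SectionalBound.

(** * Invariance of curvature under local isometries *)

Section Isometry.
Context {R : realType} {n : nat}.
Variables (U V : set 'rV[R]_n) (G H : 'rV[R]_n -> 'M[R]_n) (phi : 'rV[R]_n -> 'rV[R]_n).
Hypotheses (mG : metric_on U G) (mH : metric_on V H).
Hypotheses (sphi : smooth_on U phi) (UV : forall x, U x -> V (phi x)).
Hypothesis iso : forall x, U x -> G x = 'J phi x *m H (phi x) *m ('J phi x)^T.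
Implicit Types (i j k l : 'I_n) (x X Y Z : 'rV[R]_n).

Let oU : open U := metric_on_open mG.
Let J x := 'J phi x.
Let sJ : smx U J := smx_jacobian oU sphi.

Lemma isometry_jacobian_unit x : U x -> J x \in unitmx.
Proof.
by move=> Ux; have := metric_unit mG Ux; rewrite iso// !unitmx_mul => /andP[/andP[]].
Qed.

Lemma isometry_inner x X Y : U x ->
  inner G x X Y = inner H (phi x) (X *m J x) (Y *m J x).
Proof. by move=> Ux; rewrite /inner iso// trmx_mul !mulmxA. Qed.

(* Uniqueness of the Levi-Civita connection: T_kij = <(D_k J)_i, J_j> is
   symmetric in k, i and antisymmetric in i, j, hence zero. *)
Lemma covd_isometry k x : U x -> covd G H phi k J x = 0.
Proof.
move=> Ux.
pose T k := covd G H phi k J x *m H (phi x) *m (J x)^T.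
have TT k' : T k' + (T k')^T = 0.
  have := dm_pairing mG mH sphi UV k' sJ sJ Ux.
  have -> : dm k' (fun y => J y *m H (phi y) *m (J y)^T) x = dm k' G x.
    by apply: dm_ext oU Ux _ => y Uy; rewrite iso.
  rewrite (metric_compat mG k' Ux) -[J x *m _ *m (J x)^T]iso// -addrA.
  move=> /eqP; rewrite -subr_eq0 addrC -[X in _ - X]addrA addrA.
  rewrite /T trmx_mul trmxK trmx_mul (pbmetricT mH UV Ux) !mulmxA => /eqP E.
  apply/eqP; rewrite -oppr_eq0; apply/eqP; rewrite -[RHS]E.
  move: (conn G k' x *m G x) (G x *m (conn G k' x)^T) => a b.
  mxring.
have Tanti k' i j : T k' i j = - T k' j i.
  have := congr1 (fun A : 'M[R]_n => A i j) (TT k').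
  by rewrite addmxE [(T k')^T i j]mxE [RHS]mxE => /eqP; rewrite addr_eq0 => /eqP.
have Tsym k' i j : T k' i j = T i k' j.
  rewrite /T -!mulmxA !mulmxE; apply: eq_bigr => a _; congr (_ * _).
  exact: (covd_jacobian_sym mG mH sphi UV).
have T0 : T k = 0.
  apply/matrixP => i j; rewrite [RHS]mxE.
  (* Six alternating exchanges of the first two and of the last two indices return to k, i, j; the
     three antisymmetric ones leave a minus sign. *)
  have E : T k i j = - T k i j.
    by rewrite {1}(Tsym k i j) (Tanti i k j) (Tsym i j k) (Tanti j i k) opprK (Tsym j k i) (Tanti k j i).
  lra.
have uJ := isometry_jacobian_unit Ux; have uH := metric_unit mH (UV Ux).
have := T0; rewrite /T => /(congr1 (mulmxr (invmx (J x)^T))) /=.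
rewrite mul0mx mulmxK ?unitmx_tr// => /(congr1 (mulmxr (invmx (H (phi x))))) /=.
by rewrite mul0mx mulmxK.
Qed.

(** The Ricci identity applied to the parallel section J, whose second covariant derivatives
    vanish. *)
Lemma curv_isometry l k x : U x ->
  curv G l k x *m J x = J x *m pbcurv H phi l k x.
Proof.
move=> Ux.
have covd0 p (X : 'rV[R]_n -> 'M[R]_n) : (forall y, U y -> X y = 0) ->
    covd G H phi p X x = 0.
  move=> X0; rewrite /covd (X0 _ Ux) mulmx0 mul0mx subr0 addr0.
  by rewrite -(dm_cst 0 p x); exact: dm_ext oU Ux X0.
have D0 p q : covd G H phi p (covd G H phi q J) x = 0.
  by apply: covd0 => y Uy; exact: covd_isometry.
have := covd_comm mG mH sphi UV l k sJ Ux.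
by rewrite !D0 subrr addrC => /esym/eqP; rewrite subr_eq0 => /eqP.
Qed.

Lemma isometry_riemann x X Y Z : U x -> riemann G x X Y Z *m J x =
  riemann H (phi x) (X *m J x) (Y *m J x) (Z *m J x).
Proof.
move=> Ux; rewrite !riemannE -!mulmxA; congr (_ *m _).
rewrite {1}/curv_op mulmx_suml.
under eq_bigr => i _.
  rewrite mulmx_suml.
  under eq_bigr => j _ do rewrite -scalemxAl (curv_isometry _ _ Ux) scalemxAr.
  rewrite -mulmx_sumr.
  over.
by rewrite -mulmx_sumr curv_op_mul.
Qed.

Lemma isometry_sectional x X Y : U x ->
  sectional G x X Y = sectional H (phi x) (X *m J x) (Y *m J x).
Proof.
by move=> Ux; rewrite /sectional !(isometry_inner _ _ Ux) isometry_riemann.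
Qed.

End Isometry.

(** * Bochner's formula *)

(** The rows of P form an orthonormal basis for G. The induction splits off the first basis vector,
    as in a Cholesky factorisation. *)
Lemma posdef_frame (R : realType) n (G : 'M[R]_n) : G^T = G ->
  (forall v : 'rV[R]_n, v != 0 -> 0 < (v *m G *m v^T) 0 0) ->
  exists P : 'M[R]_n, P *m G *m P^T = 1%:M.
Proof.
elim: n G => [|n IH] G GT pG; first by exists 0; apply/matrixP => -[].
pose A : 'M[R]_(1 + n) := G.
pose a := A 0 0; pose b : 'rV[R]_n := ursubmx A; pose D : 'M[R]_n := drsubmx A.
have AE : A = block_mx a%:M b b^T D.
  rewrite -[LHS]submxK; congr block_mx.
    by rewrite [LHS]mx11_scalar; congr _%:M; rewrite !mxE; congr (A _ _); apply/val_inj.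
  by rewrite /b trmx_ursub GT.
have DT : D^T = D by rewrite /D trmx_drsub GT.
have qA (s : 'rV[R]_1) (v : 'rV[R]_n) : row_mx s v *m A *m (row_mx s v)^T =
    a *: (s *m s^T) + v *m b^T *m s^T + (s *m b *m v^T + v *m D *m v^T).
  rewrite AE mul_row_block tr_row_mx mul_row_col !mulmxDl.
  by rewrite mul_mx_scalar -scalemxAl.
have a0 : 0 < a.
  have := pG (row_mx 1%:M 0); rewrite -/A qA.
  rewrite trmx0 !mulmx0 !mul0mx !addr0 trmx1 mulmx1 scalemxE mxE eqxx mulr1.
  apply; apply/eqP => /(congr1 (@lsubmx _ 1 1 n)); rewrite row_mxKl linear0.
  by move=> /(congr1 (fun B : 'M[R]_1 => B 0 0)); rewrite !mxE eqxx => /eqP; rewrite oner_eq0.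
have an0 : a != 0 by rewrite gt_eqF.
pose D' := D - a^-1 *: (b^T *m b).
have D'T : D'^T = D' by rewrite /D' trmxD trmxN linearZ /= trmx_mul trmxK DT.
(* D' is the Schur complement of the top left entry. *)
have pD' (v : 'rV[R]_n) : v != 0 -> 0 < (v *m D' *m v^T) 0 0.
  (* With v fixed, this first coordinate completes the square: it minimises the quadratic form of G,
     and the minimum is v D' v^T. *)
  move=> v0; have := pG (row_mx (- (a^-1 *: (v *m b^T))) v); rewrite -/A qA.
  set s := _ *: _.
  have E : v *m D' *m v^T = a *: (- s *m (- s)^T) + v *m b^T *m (- s)^T
      + (- s *m b *m v^T + v *m D *m v^T).
    have sT : s^T = a^-1 *: (b *m v^T) by rewrite /s linearZ /= trmx_mul trmxK.
    rewrite trmxN mulmxN mulNmx opprK mulNmx mulNmx sT /s /D' mulmxBr mulmxBl.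
    rewrite !(mulmxN, mulNmx, =^~ scalemxAl, =^~ scalemxAr) !mulmxA.
    by apply/matrixP => i j; rewrite !(addmxE, oppmxE, scalemxE); field.
  rewrite -E; apply; apply: contra v0 => /eqP.
  by move=> /(congr1 (@rsubmx _ 1 1 n)); rewrite row_mxKr linear0 => ->.
have [P' HP'] := IH D' D'T pD'.
pose s := (Num.sqrt a)^-1.
have ss : s * a * s = 1.
  by rewrite mulrC mulrA -expr2 /s exprVn sqr_sqrtr ?ltW// mulVf.
(* The first row normalises e_0; the others apply P' to the vectors e_j - (b_j / a) e_0, which are
   orthogonal to e_0. *)
pose P : 'M[R]_(1 + n) := block_mx s%:M 0 (- (a^-1 *: (P' *m b^T))) P'.
suff HP : P *m A *m P^T = 1%:M by exists P.
rewrite AE /P mulmx_block tr_block_mx mulmx_block.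
rewrite !trmx0 !mulmx0 !mul0mx !addr0 tr_scalar_mx -!scalar_mxM ss.
set X := - _; have XT : X^T = - (a^-1 *: (b *m P'^T)).
  by rewrite /X trmxN linearZ /= trmx_mul trmxK.
have Xa : X *m a%:M + P' *m b^T = 0.
  rewrite /X mul_mx_scalar scalerN scalerA mulfV// scale1r addrC.
  exact: subrr.
rewrite Xa !mul0mx !add0r.
have -> : (s * a)%:M *m X^T + s%:M *m b *m P'^T = 0.
  rewrite XT !mul_scalar_mx !(mulmxN, mulNmx, =^~ scalemxAl, =^~ scalemxAr).
  by apply/matrixP => i j; rewrite !(addmxE, oppmxE, scalemxE) [RHS]mxE; field.
have -> : (X *m b + P' *m D) *m P'^T = 1%:M.
  rewrite mulmxDl -HP' /D' /X mulmxBr mulmxBl.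
  rewrite !(mulmxN, mulNmx, =^~ scalemxAl, =^~ scalemxAr) !mulmxA.
  exact: addrC.
by rewrite -scalar_mx_block.
Qed.

Section Bochner.
Context {R : realType} {n m : nat}.
Variables (U : set 'rV[R]_n) (G : 'rV[R]_n -> 'M[R]_n).
Variables (V : set 'rV[R]_m) (H : 'rV[R]_m -> 'M[R]_m) (F : 'rV[R]_n -> 'rV[R]_m).
Hypotheses (mG : metric_on U G) (mH : metric_on V H).
Hypotheses (sF : smooth_on U F) (UV : forall x, U x -> V (F x)).
Implicit Types (i j k l p : 'I_n) (a b c : 'I_m) (x y : 'rV[R]_n).

Let oU : open U := metric_on_open mG.
Let E x := 'J F x.
Let sE : smx U E := smx_jacobian oU sF.
Let g x := invmx (G x).
Let h x := H (F x).
Let S k := covd G H F k E.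
Let sS k : smx U (S k) := smx_covd mG mH sF UV k sE.
Let u := energy_density_loc G H F.

Lemma smf_energy_density : smf U u.
Proof.
have sh := smx_pbmetric mG mH sF UV.
have s1 := smxM oU (smxM oU sE sh) (smxT oU sE).
exact: (smf_tr oU (smxM oU (smx_invmetric mG) s1)).
Qed.

Lemma tr_pairing_sym x (A B : 'M[R]_(n, m)) : U x ->
  \tr (g x *m (A *m h x *m B^T)) = \tr (g x *m (B *m h x *m A^T)).
Proof.
move=> Ux; rewrite -mxtrace_tr !trmx_mul trmxK (pbmetricT mH UV Ux) (invmetricT mG Ux).
by rewrite mxtrace_mulC !mulmxA.
Qed.

Lemma pd_energy_density k x : U x ->
  pd k u x = 2 * \tr (g x *m (S k x *m h x *m (E x)^T)).
Proof.
move=> Ux; have -> : pd k u x = \tr (g x *m (S k x *m h x *m (E x)^T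
     + E x *m h x *m (S k x)^T)).
  exact: (pd_tr_pairing mG mH sF UV k sE sE Ux).
by rewrite mulmxDr mxtraceD (tr_pairing_sym (E x) _ Ux); ring.
Qed.

Lemma pd2_energy_density l k x : U x ->
  pd l (pd k u) x = 2 * (\tr (g x *m (covd G H F l (S k) x *m h x *m (E x)^T))
                       + \tr (g x *m (S k x *m h x *m (S l x)^T))).
Proof.
move=> Ux; have D := pd_tr_pairing mG mH sF UV l (sS k) sE Ux.
rewrite mulmxDr mxtraceD -/(S l) in D; rewrite -[X in 2 * X]D.
set f := fun y => \tr _.
have sf : smf U f.
  have sh := smx_pbmetric mG mH sF UV.
  have s1 := smxM oU (smxM oU (sS k) sh) (smxT oU sE).
  exact: (smf_tr oU (smxM oU (smx_invmetric mG) s1)).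
transitivity (pd l (fun y => 2 * f y) x).
  by apply: pd_ext oU Ux _ => y Uy; rewrite pd_energy_density.
by rewrite (pdM l (smf_cst U 2) sf Ux) pd_cst mul0r add0r.
Qed.

(* The curvature term produced by commuting covariant derivatives of dF. *)
Definition ricci_identity_term l i x : 'M[R]_(n, m) :=
  - (curv G l i x *m E x) + E x *m pbcurv H F l i x.
Let C := ricci_identity_term.

(** By symmetry of the second fundamental form, S_k in row i is S_i in row k, and the Ricci identity
    then commutes the derivatives in l and i. The two sums arise because [covd] differentiates the
    row index covariantly but not the parameter, and these roles are exchanged. *)
Lemma covd_exchange l k i a x : U x ->
  covd G H F l (S k) x i a = covd G H F i (S l) x k a + C l i x k a
    + \sum_p conn G l x k p * S p x i a - \sum_p conn G l x i p * S k x p a.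
Proof.
move=> Ux.
have symS p q b y : U y -> S p y q b = S q y p b.
  exact: (covd_jacobian_sym mG mH sF UV).
have dS : dm l (S k) x i a = dm l (S i) x k a.
  by rewrite !dmE; apply: pd_ext oU Ux _ => y; exact: symS.
have cE p q b : covd G H F l (S p) x q b = dm l (S p) x q b
    - \sum_r conn G l x q r * S p x r b
    + \sum_c S p x q c * pbconn H F l x c b.
  by rewrite /covd -/(S p) !addmxE oppmxE !mulmxE.
have step : covd G H F l (S k) x i a = covd G H F l (S i) x k a
    + \sum_p conn G l x k p * S p x i a - \sum_p conn G l x i p * S k x p a.
  rewrite !cE dS.
  have -> : \sum_c S k x i c * pbconn H F l x c a = \sum_c S i x k c * pbconn H F l x c a.
    by apply: eq_bigr => c _; rewrite symS.
  have -> : \sum_r conn G l x k r * S i x r a = \sum_p conn G l x k p * S p x i a.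
    by apply: eq_bigr => r _; rewrite symS.
  ring.
have := congr1 (fun A : 'M[R]_(n, m) => A k a) (covd_comm mG mH sF UV l i sE Ux).
rewrite addmxE oppmxE -/(S i) -/(S l) -/(ricci_identity_term l i x) -/C => ci.
have {ci} ci : covd G H F l (S i) x k a = covd G H F i (S l) x k a + C l i x k a.
  by rewrite -ci addrC subrK.
by rewrite step ci.
Qed.

Hypothesis F_harmonic : forall y, U y -> tension_loc G H F y = 0.

(* The covariant derivative of the vanishing tension field. *)
Lemma covd_tension i a x : U x ->
  \sum_k \sum_l g x k l * covd G H F i (S l) x k a =
  \sum_k \sum_l g x k l * \sum_p conn G l x i p * S k x p a.
Proof.
move=> Ux; have sg := smx_invmetric mG.
have symS p q b y : U y -> S p y q b = S q y p b.
  exact: (covd_jacobian_sym mG mH sF UV).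
have gsym y k l : U y -> g y k l = g y l k.
  by move=> Uy; have := congr1 (fun A : 'M[R]_n => A l k) (invmetricT mG Uy); rewrite [LHS]mxE.
have t0 b y : U y -> \sum_l (g y *m S l y) l b = 0.
  move=> Uy; have := congr1 (fun v : 'rV[R]_m => v 0 b) (F_harmonic Uy).
  rewrite (tension_locE H mG sF b Uy) [RHS]mxE => t0; rewrite -[RHS]t0.
  by apply: eq_bigr => l _; rewrite mulmxE.
have sT l : smx U (fun y => g y *m S l y) by exact: smxM.
have : \sum_l dm i (fun y => g y *m S l y) x l a = 0.
  have p0 : pd i (fun y => \sum_l (g y *m S l y) l a) x = 0.
    by rewrite -[RHS](pd_cst (0 : R) i x); apply: pd_ext oU Ux _ => y Uy; rewrite t0.
  rewrite -[RHS]p0 [RHS](pd_sum _ i oU _ Ux); last by move=> l _; exact: sT.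
  by apply: eq_bigr => l _; rewrite dmE.
have dT l : dm i (fun y => g y *m S l y) x =
    g x *m covd G H F i (S l) x - (conn G i x)^T *m g x *m S l x
    - g x *m S l x *m pbconn H F i x.
  rewrite (dmM i oU sg (sS l) Ux) (dm_invmx i oU (metric_unit mG) (smx_metric mG) Ux).
  rewrite (metric_compat mG i Ux) /covd -/(S l) -/(g x).
  have uG := metric_unit mG Ux.
  have -> : g x *m (conn G i x *m G x + G x *m (conn G i x)^T) *m g x =
      g x *m conn G i x + (conn G i x)^T *m g x.
    by rewrite mulmxDr mulmxDl !mulmxA mulmxK// mulVmx// mul1mx.
  move: (g x) (conn G i x) (S l x) (pbconn H F i x) (dm i (S l) x) => g0 A s B ds.
  rewrite !(mulmxDl, mulmxDr, mulNmx, mulmxN) !mulmxA.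
  mxring.
under eq_bigr => l _ do rewrite dT !addmxE !oppmxE.
rewrite !sumrB.
have -> : \sum_l (g x *m S l x *m pbconn H F i x) l a = 0.
  under eq_bigr => l _ do rewrite mulmxE.
  by rewrite exchange_big big1// => b _; rewrite -mulr_suml t0// mul0r.
rewrite subr0 => /eqP; rewrite subr_eq0 => /eqP e.
transitivity (\sum_l (g x *m covd G H F i (S l) x) l a).
  rewrite exchange_big; apply: eq_bigr => l _; rewrite mulmxE.
  by apply: eq_bigr => k _; rewrite gsym.
rewrite e.
transitivity (\sum_l \sum_p \sum_k conn G i x p l * (g x p k * S l x k a)).
  apply: eq_bigr => l _; rewrite -mulmxA mulmxE; apply: eq_bigr => p _.
  by rewrite mxE mulmxE mulr_sumr.
rewrite exchange_big /=.
transitivity (\sum_p \sum_k \sum_l conn G i x p l * (g x p k * S l x k a)).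
  by apply: eq_bigr => p _; rewrite exchange_big.
rewrite exchange_big; apply: eq_bigr => k _; apply: eq_bigr => l _ /=.
rewrite mulr_sumr; apply: eq_bigr => p _.
by rewrite (conn_sym mG l i p Ux) (symS k p a x Ux) (gsym x k l Ux); ring.
Qed.

(** After contraction with g, the vanishing derivative of the tension cancels one Christoffel sum of
    [covd_exchange]. The other one, g^kl Gamma^p_lk S_p, survives and is the Christoffel term of the
    Laplacian. *)
Lemma rough_laplacian i a x : U x ->
  \sum_k \sum_l g x k l * covd G H F l (S k) x i a =
  \sum_k \sum_l g x k l * (C l i x k a + \sum_p conn G l x k p * S p x i a).
Proof.
move=> Ux.
transitivity (\sum_k \sum_l (g x k l * covd G H F i (S l) x k a
  + g x k l * (C l i x k a + \sum_p conn G l x k p * S p x i a)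
  - g x k l * \sum_p conn G l x i p * S k x p a)).
  apply: eq_bigr => k _; apply: eq_bigr => l _; rewrite (covd_exchange l k i a Ux).
  ring.
under eq_bigr => k _ do rewrite sumrB big_split.
rewrite sumrB big_split /= covd_tension//.
by rewrite [X in X - _]addrC addrK.
Qed.

(* At a critical point of u the Christoffel term of the Laplacian vanishes, so that
   the formula holds in arbitrary coordinates with g^kl d_k d_l u on the left. *)
Lemma bochner_critical x : U x -> (forall k, pd k u x = 0) ->
  \sum_k \sum_l g x k l * pd l (pd k u) x =
  2 * (\sum_k \sum_l g x k l *
         (\sum_i (C l i x *m (h x *m (E x)^T *m g x)) k i)
     + \sum_k \sum_l g x k l * \tr (g x *m (S k x *m h x *m (S l x)^T))).
Proof.
move=> Ux crit; pose K := h x *m (E x)^T *m g x.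
have trK (A : 'M[R]_(n, m)) : \tr (g x *m (A *m h x *m (E x)^T)) =
    \sum_i \sum_a A i a * K a i.
  transitivity (\tr (A *m K)); first by rewrite mxtrace_mulC /K !mulmxA.
  by apply: eq_bigr => i _; rewrite mulmxE.
have -> : \sum_k \sum_l g x k l * pd l (pd k u) x =
  2 * (\sum_k \sum_l g x k l *
        \tr (g x *m (covd G H F l (S k) x *m h x *m (E x)^T))
     + \sum_k \sum_l g x k l * \tr (g x *m (S k x *m h x *m (S l x)^T))).
  rewrite -big_split mulr_sumr; apply: eq_bigr => k _ /=.
  rewrite -big_split mulr_sumr; apply: eq_bigr => l _ /=.
  by rewrite pd2_energy_density//; ring.
congr (2 * (_ + _)).
transitivity (\sum_i \sum_a
   (\sum_k \sum_l g x k l * covd G H F l (S k) x i a) * K a i).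
  under eq_bigr => k _ do under eq_bigr => l _ do rewrite trK mulr_sumr.
  under [RHS]eq_bigr => i _ do under eq_bigr => a _ do rewrite mulr_suml.
  under [RHS]eq_bigr => i _ do rewrite exchange_big.
  rewrite [RHS]exchange_big; apply: eq_bigr => k _ /=.
  rewrite exchange_big; apply: eq_bigr => i _ /=.
  under [RHS]eq_bigr => a _ do rewrite mulr_suml.
  rewrite [RHS]exchange_big; apply: eq_bigr => l _ /=.
  by rewrite mulr_sumr; apply: eq_bigr => a _; rewrite mulrA.
transitivity (\sum_i \sum_a \sum_k \sum_l
   (g x k l * C l i x k a * K a i + g x k l *
      \sum_p conn G l x k p * (S p x i a * K a i))).
  apply: eq_bigr => i _; apply: eq_bigr => a _; rewrite rough_laplacian// mulr_suml.
  apply: eq_bigr => k _; rewrite mulr_suml; apply: eq_bigr => l _.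
  rewrite mulrDr mulrDl; congr (_ + _).
  rewrite -mulrA mulr_suml; congr (_ * _); apply: eq_bigr => p _.
  by rewrite mulrA.
have split2 : forall f1 f2 : 'I_n -> 'I_m -> 'I_n -> 'I_n -> R,
  \sum_i \sum_a \sum_k \sum_l (f1 i a k l + f2 i a k l) =
  \sum_i \sum_a \sum_k \sum_l f1 i a k l + \sum_i \sum_a \sum_k \sum_l f2 i a k l.
  move=> f1 f2; rewrite -big_split; apply: eq_bigr => i _.
  rewrite -big_split; apply: eq_bigr => a _.
  by rewrite -big_split; apply: eq_bigr => k _; rewrite -big_split.
have rot : forall f : 'I_n -> 'I_m -> 'I_n -> 'I_n -> R,
  \sum_i \sum_a \sum_k \sum_l f i a k l = \sum_k \sum_l \sum_i \sum_a f i a k l.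
  move=> f; under eq_bigr => i _ do rewrite exchange_big.
  rewrite exchange_big; apply: eq_bigr => k _ /=.
  under eq_bigr => i _ do rewrite exchange_big.
  by rewrite exchange_big.
rewrite split2 !rot [X in _ + X]big1 ?addr0 => [|k _].
  apply: eq_bigr => k _; apply: eq_bigr => l _; rewrite mulr_sumr.
  apply: eq_bigr => i _; rewrite -/K mulmxE mulr_sumr.
  by apply: eq_bigr => a _; rewrite mulrA.
rewrite big1// => l _.
(* The inner double sum is half of d_p u. *)
transitivity (g x k l * \sum_p conn G l x k p * (\sum_i \sum_a S p x i a * K a i)).
  rewrite mulr_sumr.
  under eq_bigr => i _ do under eq_bigr => a _ do rewrite mulr_sumr.
  under eq_bigr => i _ do rewrite exchange_big.
  rewrite exchange_big; apply: eq_bigr => p _ /=.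
  rewrite mulr_sumr mulr_sumr; apply: eq_bigr => i _.
  by rewrite mulr_sumr mulr_sumr.
rewrite big1 ?mulr0// => p _; rewrite -trK.
have := crit p; rewrite pd_energy_density// => /eqP.
by rewrite mulf_eq0 pnatr_eq0 /= => /eqP ->; rewrite mulr0.
Qed.

End Bochner.

(** Expand the nonnegative sum of all (a_i - a_j)^2. With a_i = |dF e_i|^2 this is the origin of the
    factor (n-1)/n. *)
Lemma sqr_sum_le (R : realDomainType) n (a : 'I_n -> R) :
  (\sum_i a i) ^+ 2 <= n%:R * \sum_i a i ^+ 2.
Proof.
have : 0 <= \sum_i \sum_j (a i - a j) ^+ 2.
  by apply: sumr_ge0 => i _; apply: sumr_ge0 => j _; exact: sqr_ge0.
have row i : \sum_j (a i - a j) ^+ 2 =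
    n%:R * a i ^+ 2 + \sum_j a j ^+ 2 - 2 * a i * \sum_j a j.
  transitivity (\sum_j (a i ^+ 2 + a j ^+ 2 - 2 * a i * a j)).
    by apply: eq_bigr => j _; ring.
  by rewrite sumrB big_split /= sumr_const card_ord -mulr_sumr -[X in X + _ - _]mulr_natl.
under eq_bigr => i _ do rewrite row.
rewrite sumrB big_split /= -mulr_sumr sumr_const card_ord -mulr_suml -mulr_sumr.
rewrite -[X in _ + X - _]mulr_natl.
set A := \sum_i a i; set B := \sum_i a i ^+ 2.
have -> : n%:R * B + n%:R * B - 2 * A * A = 2 * (n%:R * B) - 2 * A ^+ 2 by ring.
by rewrite subr_ge0 ler_pM2l.
Qed.

Section GramSum.
Context {R : realType} {n : nat}.
Variables (g P : 'M[R]_n).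
Hypothesis gP : g = P^T *m P.

(** When g is an inverse metric, the rows of P form an orthonormal frame, and the contraction with g
    becomes a trace over that frame. *)
Lemma gram_sum (T : 'I_n -> 'I_n -> R) :
  \sum_k \sum_l g k l * T k l = \sum_s \sum_k \sum_l P s k * P s l * T k l.
Proof.
rewrite [RHS]exchange_big; apply: eq_bigr => k _ /=.
rewrite [RHS]exchange_big; apply: eq_bigr => l _ /=.
rewrite gP mulmxE mulr_suml; apply: eq_bigr => s _.
by rewrite [P^T _ _]mxE.
Qed.

End GramSum.

(** * Estimating the terms of Bochner's formula at a maximum *)

Section BochnerInequality.
Context {R : realType} {n m : nat}.
Variables (U : set 'rV[R]_n) (G : 'rV[R]_n -> 'M[R]_n).
Variables (V : set 'rV[R]_m) (H : 'rV[R]_m -> 'M[R]_m) (F : 'rV[R]_n -> 'rV[R]_m).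
Hypotheses (mG : metric_on U G) (mH : metric_on V H).
Hypotheses (sF : smooth_on U F) (UV : forall x, U x -> V (F x)).
Implicit Types (i j k l s t : 'I_n) (a b c : 'I_m) (x y : 'rV[R]_n).

Let oU : open U := metric_on_open mG.
Let E x := 'J F x.
Let g x := invmx (G x).
Let h x := H (F x).
Let u := energy_density_loc G H F.

Lemma metric_frame x : U x -> exists P : 'M[R]_n, g x = P^T *m P.
Proof.
move=> Ux; have [P PGP] := posdef_frame (metricT mG Ux) (fun v => metric_on_pos mG Ux).
exists P; have uG := metric_unit mG Ux.
have PGPu : P *m (G x *m P^T) = 1%:M by rewrite mulmxA.
have := mulmx1C PGPu; rewrite -mulmxA => /(congr1 (mulmx (g x))).
by rewrite mulKmx// mulmx1 => ->.
Qed.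

Lemma pbmetric_factor x : U x -> exists Q : 'M[R]_m, h x = Q *m Q^T.
Proof.
move=> Ux; have Vx := UV Ux.
have [P PhP] := posdef_frame (metricT mH Vx) (fun v => metric_on_pos mH Vx).
have PhPu : P *m (h x *m P^T) = 1%:M by rewrite mulmxA.
have [uP _] := mulmx1_unit PhPu.
exists (invmx P); rewrite trmx_inv.
have -> : h x = invmx P *m (P *m h x *m P^T) *m invmx (P^T).
  by rewrite !mulmxA mulmxK ?unitmx_tr// mulVmx// mul1mx.
by rewrite PhP mulmx1.
Qed.

Lemma tr_pairing_sum x (A : 'M[R]_(n, m)) :
  \tr (A *m h x *m A^T) = \sum_t inner H (F x) (row t A) (row t A).
Proof.
apply: eq_bigr => t _; rewrite /inner -row_mul !mulmxE; apply: eq_bigr => a _.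
by rewrite !mxE.
Qed.

Lemma tr_pairing_ge0 x (A : 'M[R]_(n, m)) : U x -> 0 <= \tr (A *m h x *m A^T).
Proof.
move=> Ux; rewrite tr_pairing_sum; apply: sumr_ge0 => t _.
exact: (inner_ge0 mH _ (UV Ux)).
Qed.

Lemma energy_density_frame x (P : 'M[R]_n) : g x = P^T *m P ->
  u x = \tr ((P *m E x) *m h x *m (P *m E x)^T).
Proof.
move=> gP; transitivity (\tr (g x *m (E x *m h x *m (E x)^T))) => //.
by rewrite gP -(mulmxA P^T P) [LHS]mxtrace_mulC trmx_mul !mulmxA.
Qed.

Lemma energy_density_ge0 x : U x -> 0 <= u x.
Proof.
by move=> Ux; have [P gP] := metric_frame Ux; rewrite (energy_density_frame gP) tr_pairing_ge0.
Qed.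

Lemma energy_density_eq0 x : U x -> u x = 0 -> E x = 0.
Proof.
move=> Ux; have [P gP] := metric_frame Ux; rewrite (energy_density_frame gP).
rewrite tr_pairing_sum => /eqP; rewrite psumr_eq0 => [/allP e0|t _]; last first.
  exact: (inner_ge0 mH _ (UV Ux)).
have PE : P *m E x = 0.
  apply/row_matrixP => t; rewrite row0; apply/eqP/negPn/negP => r0.
  have := e0 t (mem_index_enum _) => /eqP r1.
  by have := inner_gt0 mH (UV Ux) r0; rewrite r1 ltxx.
have : g x *m E x = 0 by rewrite gP -mulmxA PE mulmx0.
by move=> /(congr1 (mulmx (G x))); rewrite mulmx0 mulKVmx// (metric_unit mG Ux).
Qed.

(** In a frame, the inner sum for each s is the squared norm of B, which is S taken in the direction
    of the s-th frame vector. *)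
Lemma second_fundamental_form_ge0 x (S : 'I_n -> 'M[R]_(n, m)) : U x ->
  0 <= \sum_k \sum_l g x k l * \tr (g x *m (S k *m h x *m (S l)^T)).
Proof.
move=> Ux; have [P gP] := metric_frame Ux; rewrite (gram_sum gP).
apply: sumr_ge0 => s _; pose B := \sum_k P s k *: (P *m S k).
have -> : \sum_k \sum_l P s k * P s l * \tr (g x *m (S k *m h x *m (S l)^T)) =
    \tr (B *m h x *m B^T); last exact: tr_pairing_ge0.
rewrite /B !mulmx_suml (raddf_sum (@mxtrace R n)) /=; apply: eq_bigr => k _.
rewrite (raddf_sum trmx) mulmx_sumr (raddf_sum (@mxtrace R n)) /=.
apply: eq_bigr => l _; rewrite linearZ /= -!scalemxAl -scalemxAr scalerA mxtraceZ.
by rewrite gP -(mulmxA P^T P) [in LHS]mxtrace_mulC trmx_mul !mulmxA.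
Qed.

(** The columns of Z are the vectors df^* w_a, for the orthonormal frame of the target encoded by Q.
    Their squared norms add up to u, and their Ricci curvatures to the contraction of [curv] with Z
    Z^T. *)
Lemma ricci_term x (rho : R) : U x ->
  (forall X, rho * inner G x X X <= ricci G x X X) ->
  rho * u x <= - \sum_k \sum_l g x k l *
    (\sum_i (curv G l i x *m E x *m (h x *m (E x)^T *m g x)) k i).
Proof.
move=> Ux hrho; have [Q hQ] := pbmetric_factor Ux; have uG := metric_unit mG Ux.
have gT : (g x)^T = g x := invmetricT mG Ux.
pose Z := g x *m E x *m Q.
have ZZ : g x *m E x *m (h x *m (E x)^T *m g x) = Z *m Z^T.
  by rewrite /Z hQ !trmx_mul gT !mulmxA.
have -> : rho * u x = \sum_a rho * inner G x (col a Z)^T (col a Z)^T.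
  rewrite -mulr_sumr; congr (_ * _).
  transitivity (\tr (Z^T *m G x *m Z)).
    transitivity (\tr (g x *m (E x *m h x *m (E x)^T))) => //.
    have GZ : G x *m Z = E x *m Q by rewrite /Z !mulmxA mulmxV// mul1mx.
    rewrite -(mulmxA Z^T) GZ hQ.
    transitivity (\tr (Z *m (E x *m Q)^T)); first by rewrite /Z trmx_mul !mulmxA.
    by rewrite -mxtrace_tr trmx_mul trmxK mxtrace_mulC.
  apply: eq_bigr => a _; rewrite /inner trmxK.
  rewrite !mulmxE; apply: eq_bigr => i _; rewrite [X in _ = _ * X]mxE; congr (_ * _).
  by rewrite !mulmxE; apply: eq_bigr => j _; rewrite !mxE.
apply: le_trans (ler_sum _ (fun a _ => hrho _)) _.
rewrite le_eqVlt; apply/orP; left; apply/eqP.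
(* Metric antisymmetry of the curvature carries g across [curv]; its sign absorbs the minus in the
   statement. *)
have gcurv l i : g x *m curv G l i x = - ((curv G l i x)^T *m g x).
  have := curv_metric_anti mG l i Ux; rewrite trmx_mul (metricT mG Ux).
  move=> /(congr1 (fun A => g x *m A *m g x)).
  rewrite mulKmx// mulmxN mulNmx !mulmxA mulmxK// => ->.
  by rewrite opprK.
transitivity (\sum_l \sum_i \sum_p curv G l i x p l * (Z *m Z^T) p i); last first.
  rewrite [in RHS]exchange_big -sumrN; apply: eq_bigr => l _ /=.
  under [in RHS]eq_bigr => k _ do rewrite mulr_sumr.
  rewrite [in RHS]exchange_big -sumrN; apply: eq_bigr => i _ /=.
  transitivity (- (g x *m (curv G l i x *m E x *m (h x *m (E x)^T *m g x))) l i).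
    have -> : g x *m (curv G l i x *m E x *m (h x *m (E x)^T *m g x)) =
        - ((curv G l i x)^T *m (Z *m Z^T)) by rewrite -ZZ !mulmxA gcurv !mulNmx.
    rewrite oppmxE opprK mulmxE.
    by apply: eq_bigr => p _; rewrite [(curv G l i x)^T _ _]mxE.
  congr (- _); rewrite mulmxE; apply: eq_bigr => k _; congr (_ * _).
  by rewrite -[in LHS]gT mxE.
transitivity (\sum_i \sum_p (\sum_a Z i a * Z p a) * \sum_l curv G l i x p l).
  under eq_bigr => a _ do rewrite ricciE.
  rewrite exchange_big; apply: eq_bigr => i _ /=.
  rewrite exchange_big; apply: eq_bigr => p _ /=.
  rewrite mulr_suml; apply: eq_bigr => a _; congr (_ * _).
    by rewrite !mxE.
rewrite [RHS]exchange_big; apply: eq_bigr => i _ /=.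
rewrite [RHS]exchange_big; apply: eq_bigr => p _ /=.
rewrite mulr_sumr; apply: eq_bigr => l _; rewrite mulmxE mulrC; congr (_ * _).
by apply: eq_bigr => a _; rewrite [Z^T _ _]mxE mulrC.
Qed.

Lemma sectional_term x (kappa : R) : (0 < n)%N -> U x -> 0 <= kappa ->
  (forall X Y, sec_num H (F x) X Y <= kappa * sec_den H (F x) X Y) ->
  - (kappa * ((n%:R - 1) / n%:R) * u x ^+ 2) <= \sum_k \sum_l g x k l *
    (\sum_i (E x *m pbcurv H F l i x *m (h x *m (E x)^T *m g x)) k i).
Proof.
move=> n0 Ux k0 hk; have [P gP] := metric_frame Ux; have Vx := UV Ux.
pose e s := row s (P *m E x).
have eE s : e s = row s P *m E x by rewrite /e row_mul.
have -> : \sum_k \sum_l g x k l *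
    (\sum_i (E x *m pbcurv H F l i x *m (h x *m (E x)^T *m g x)) k i) =
    \sum_s \sum_t - sec_num H (F x) (e t) (e s).
  rewrite (gram_sum gP); apply: eq_bigr => s _.
  transitivity (\sum_l \sum_i \sum_t P s l * P t i *
     (e s *m pbcurv H F l i x *m h x *m (e t)^T) 0 0).
    rewrite exchange_big; apply: eq_bigr => l _ /=.
    under eq_bigr => k _ do rewrite mulr_sumr.
    rewrite exchange_big; apply: eq_bigr => i _ /=.
    set W := pbcurv H F l i x *m (h x *m (E x)^T).
    transitivity (P s l * (e s *m W *m P^T *m P) 0 i).
      have -> : e s *m W *m P^T *m P = row s P *m (E x *m W *m P^T *m P).
        by rewrite eE !mulmxA.
      have -> : E x *m pbcurv H F l i x *m (h x *m (E x)^T *m g x) =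
        E x *m W *m P^T *m P by rewrite gP /W !mulmxA.
      rewrite mulmxE mulr_sumr; apply: eq_bigr => k _.
      by rewrite [row s P _ _]mxE; ring.
    rewrite mulmxE mulr_sumr; apply: eq_bigr => t _.
    rewrite -mulrA; congr (_ * _); rewrite mulrC; congr (_ * _).
    rewrite (eE t) trmx_mul /W !mulmxA [LHS]mulmxE [RHS]mulmxE.
    by apply: eq_bigr => j _; congr (_ * _); rewrite !mxE.
  transitivity (\sum_t \sum_l \sum_i P s l * P t i *
     (e s *m pbcurv H F l i x *m h x *m (e t)^T) 0 0).
    rewrite [RHS]exchange_big; apply: eq_bigr => l _ /=.
    by rewrite [RHS]exchange_big.
  (* The sum contains R(e_s, e_t) where [sec_num] has R(e_t, e_s), whence the minus sign. *)
  apply: eq_bigr => t _; rewrite /sec_num riemannE (curv_op_anti mH _ _ Vx).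
  rewrite mulmxN /inner !mulNmx oppmxE opprK.
  rewrite [in RHS](eE s) [in X in _ *m curv_op _ _ _ X](eE t) curv_op_mul -(eE s).
  rewrite mulmx_sumr !mulmx_suml summxE; apply: eq_bigr => l _.
  rewrite mulmx_sumr !mulmx_suml summxE; apply: eq_bigr => i _.
  by rewrite -scalemxAr -!scalemxAl scalemxE ![row _ P _ _]mxE.
have uE : u x = \sum_s inner H (F x) (e s) (e s).
  by rewrite (energy_density_frame gP) tr_pairing_sum.
have n0' : 0 < n%:R :> R by rewrite ltr0n.
(* Of the subtracted squares <e_t, e_s>^2 only the diagonal ones are kept; by [sqr_sum_le] they
   amount to at least u^2 / n. *)
have den : \sum_s \sum_t sec_den H (F x) (e t) (e s) <= (n%:R - 1) / n%:R * u x ^+ 2.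
  have cs := sqr_sum_le (fun s => inner H (F x) (e s) (e s)).
  rewrite -uE in cs.
  have -> : \sum_s \sum_t sec_den H (F x) (e t) (e s) =
      u x ^+ 2 - \sum_s \sum_t inner H (F x) (e t) (e s) ^+ 2.
    rewrite expr2 {1}uE mulr_suml -sumrB; apply: eq_bigr => s _.
    rewrite uE mulr_sumr -sumrB; apply: eq_bigr => t _.
    by rewrite /sec_den mulrC.
  have dg : \sum_s inner H (F x) (e s) (e s) ^+ 2 <=
      \sum_s \sum_t inner H (F x) (e t) (e s) ^+ 2.
    apply: ler_sum => s _; rewrite [leRHS](bigD1 s)//= lerDl.
    by apply: sumr_ge0 => t _; exact: sqr_ge0.
  rewrite mulrAC ler_pdivlMr//.
  have := ler_wpM2l (ltW n0') dg; move: cs.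
  set a := \sum_s _; set b := \sum_s _; move=> c1 c2.
  rewrite mulrC; lra.
have -> : kappa * ((n%:R - 1) / n%:R) * u x ^+ 2 =
  kappa * ((n%:R - 1) / n%:R * u x ^+ 2) by ring.
rewrite lerNl -sumrN; under eq_bigr => s _ do rewrite -sumrN.
under eq_bigr => s _ do under eq_bigr => t _ do rewrite opprK.
apply: le_trans (ler_wpM2l k0 den); rewrite mulr_sumr; apply: ler_sum => s _.
by rewrite mulr_sumr; apply: ler_sum => t _.
Qed.

Lemma bochner_max x (rho kappa : R) : (0 < n)%N -> U x ->
  (forall y, U y -> tension_loc G H F y = 0) ->
  (forall y, U y -> u y <= u x) ->
  (forall X, rho * inner G x X X <= ricci G x X X) -> 0 <= kappa ->
  (forall X Y, sec_num H (F x) X Y <= kappa * sec_den H (F x) X Y) ->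
  rho * u x <= kappa * ((n%:R - 1) / n%:R) * u x ^+ 2.
Proof.
move=> n0 Ux harm umax hrho k0 hk.
have su : smf U u := smf_energy_density mG mH sF UV.
have crit k : pd k u x = 0 := max_pd0 k oU su Ux umax.
have [P gP] := metric_frame Ux.
(* With g = P^T P, this is the sum of the coordinate Hessian of u evaluated on the rows of P. *)
have L : \sum_k \sum_l g x k l * pd l (pd k u) x <= 0.
  rewrite (gram_sum gP); apply: sumr_le0 => s _.
  apply: le_trans (max_hessian_le0 (row s P) oU su Ux umax).
  rewrite exchange_big le_eqVlt; apply/orP; left; apply/eqP.
  apply: eq_bigr => l _; apply: eq_bigr => k _ /=.
  by rewrite ![row s P _ _]mxE; ring.
have B := bochner_critical mG mH sF UV harm Ux crit.
have R1 := ricci_term Ux hrho.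
have R2 := sectional_term n0 Ux k0 hk.
have R3 := second_fundamental_form_ge0 (fun k => covd G H F k E x) Ux.
have sp : \sum_k \sum_l g x k l *
      (\sum_i (ricci_identity_term G H F l i x *m (h x *m (E x)^T *m g x)) k i) =
    - (\sum_k \sum_l g x k l *
      (\sum_i (curv G l i x *m E x *m (h x *m (E x)^T *m g x)) k i)) +
    \sum_k \sum_l g x k l *
      (\sum_i (E x *m pbcurv H F l i x *m (h x *m (E x)^T *m g x)) k i).
  rewrite -sumrN -big_split; apply: eq_bigr => k _ /=.
  rewrite -sumrN -big_split; apply: eq_bigr => l _ /=.
  rewrite -mulrN -mulrDr; congr (_ * _).
  rewrite -sumrN -big_split; apply: eq_bigr => i _ /=.
  by rewrite /ricci_identity_term mulmxDl mulNmx addmxE oppmxE.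
rewrite B sp in L.
lra.
Qed.

End BochnerInequality.

(** * Globalization *)

Lemma invmx_mul (R : comUnitRingType) n (A B : 'M[R]_n) :
  A \in unitmx -> B \in unitmx -> invmx (A *m B) = invmx B *m invmx A.
Proof.
move=> uA uB; have uAB : A *m B \in unitmx by rewrite unitmx_mul uA.
have e : A *m B *m (invmx B *m invmx A) = 1%:M.
  by rewrite mulmxA (mulmxK uB) (mulmxV uA).
by rewrite -[RHS](mulKmx uAB) e mulmx1.
Qed.

(** * From charts to the manifold *)

Section Charts.
Context {R : realType} {n : nat} {M : smoothManifold R n}.
Implicit Types (c d : chart R n M) (p q : M) (W : set M).

Lemma chart_map_continuous c p : chart_dom c p -> {for p, continuous (chart_map c)}.
Proof.
move=> cp; have := @chart_map_cont _ _ _ c.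
by rewrite (continuous_open_subspace _ (chart_dom_open c)); apply; rewrite inE.
Qed.

Lemma chart_inv_continuous c p : chart_dom c p ->
  {for chart_map c p, continuous (chart_inv c)}.
Proof.
move=> cp; have := @chart_inv_cont _ _ _ c.
rewrite (continuous_open_subspace _ (@chart_img_open _ _ _ c)); apply.
by rewrite inE; exists p.
Qed.

Lemma chart_image_open c W : open W -> open (chart_map c @` (chart_dom c `&` W)).
Proof.
move=> oW; rewrite openE => _ [p [cp Wp] <-].
have n1 : nbhs (chart_map c p) (chart_map c @` chart_dom c).
  by apply: open_nbhs_nbhs; split; [exact: (@chart_img_open _ _ _ c)|exists p].
have n2 : nbhs (chart_map c p) (chart_inv c @^-1` W).
  apply: (chart_inv_continuous cp); rewrite (chart_mapK cp).
  exact: open_nbhs_nbhs.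
rewrite /interior; apply: filterS (filterI n1 n2) => _ [[q cq <-]].
by rewrite /preimage /= (chart_mapK cq) => Wq; exists q.
Qed.

Lemma chart_dom_nbhs c p : chart_dom c p -> nbhs p (chart_dom c).
Proof. by move=> cp; apply: open_nbhs_nbhs; split => //; exact: chart_dom_open. Qed.

Variable g : riemannianMetric M.

Lemma chart_metric_on c W : atlas c -> open W ->
  metric_on (chart_map c @` (chart_dom c `&` W)) (g c).
Proof.
move=> ac oW; split.
- exact: chart_image_open.
- move=> k; apply: (Ck_sub _ (metric_smooth g ac k)) => _ [p [cp _] <-].
  by exists p.
- by move=> _ [p [cp _] <-]; exact: (Defs.metric_sym g ac cp).
- by move=> _ v [p [cp _] <-] v0; exact: (metric_pos g ac cp v0).
Qed.

Lemma chart_metric_onT c : atlas c -> metric_on (chart_map c @` chart_dom c) (g c).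
Proof. by move=> ac; have := chart_metric_on ac openT; rewrite setIT. Qed.

(** The change of charts is an isometry by the tensor law of the metric. Existence of some X', Y'
    suffices for transporting a bound that holds for all pairs. *)
Lemma chart_change_sectional c d p (X Y : 'rV[R]_n) :
  atlas c -> atlas d -> chart_dom c p -> chart_dom d p ->
  exists X' Y', sectional (g c) (chart_map c p) X Y =
                sectional (g d) (chart_map d p) X' Y'.
Proof.
move=> ac ad cp dp.
have UV x : (chart_map c @` (chart_dom c `&` chart_dom d)) x ->
    (chart_map d @` chart_dom d) (chart_transition c d x).
  move=> [q [cq dq] <-]; rewrite /chart_transition /= (chart_mapK cq).
  by exists q.
have iso x : (chart_map c @` (chart_dom c `&` chart_dom d)) x ->
    g c x = 'J (chart_transition c d) x *m g d (chart_transition c d x)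
            *m ('J (chart_transition c d) x)^T.
  move=> [q [cq dq] <-]; rewrite (metric_change g ac ad cq dq).
  by rewrite /chart_transition /= (chart_mapK cq).
have := isometry_sectional (chart_metric_on ac (chart_dom_open d))
  (chart_metric_onT ad) (atlas_smooth ac ad) UV iso X Y.
move=> /(_ (chart_map c p)) -> //; last by exists p.
rewrite {1 2}/chart_transition /= (chart_mapK cp).
by eexists; eexists.
Qed.

End Charts.

Section JacobianComp.
Context {R : realType} {n m k : nat}.

Lemma jacobian_comp (phi : 'rV[R]_n -> 'rV[R]_m) (psi : 'rV[R]_m -> 'rV[R]_k) x :
  differentiable phi x -> differentiable psi (phi x) ->
  'J (psi \o phi) x = 'J phi x *m 'J psi (phi x).
Proof.
move=> dphi dpsi; have dc := differentiable_comp dphi dpsi.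
apply/row_matrixP => i; rewrite row_mul !rowE.
rewrite -(deriveEjacobian _ dc) -(deriveEjacobian _ dphi) -(deriveEjacobian _ dpsi).
by rewrite (deriveE _ dc) (deriveE _ dphi) (deriveE _ dpsi) (diff_comp dphi dpsi).
Qed.

Lemma jacobian_near_eq (phi psi : 'rV[R]_n -> 'rV[R]_m) x :
  (\forall y \near x, phi y = psi y) -> differentiable phi x ->
  'J phi x = 'J psi x.
Proof.
move=> e dphi; have dpsi := near_eq_differentiable e dphi.
apply/matrixP => i a.
transitivity (pd i (fun y => phi y 0 a) x); first exact: jacobianE.
transitivity (pd i (fun y => psi y 0 a) x); last exact/esym/jacobianE.
rewrite !pdE; apply: near_eq_derive.
by apply: filterS e => y ->.
Qed.

End JacobianComp.

Section EnergyDensity.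
Context {R : realType} {n m : nat}.
Context {M : smoothManifold R n} {N : smoothManifold R m}.
Variables (g : riemannianMetric M) (h : riemannianMetric N) (f : M -> N).
Hypothesis f_smooth : smooth_map f.
Implicit Types (c : chart R n M) (d : chart R m N) (p q : M).

Definition map_dom c d : set 'rV[R]_n :=
  chart_map c @` (chart_dom c `&` f @^-1` chart_dom d).

Lemma preim_dom_open d : open (f @^-1` chart_dom d).
Proof. by apply: open_comp; [move=> x _; exact: f_smooth.1|exact: chart_dom_open]. Qed.

Lemma map_dom_metric c d : atlas c -> metric_on (map_dom c d) (g c).
Proof. by move=> ac; apply: chart_metric_on => //; exact: preim_dom_open. Qed.

Lemma local_repE c d p : chart_dom c p ->
  local_rep f c d (chart_map c p) = chart_map d (f p).
Proof. by move=> cp; rewrite /local_rep /= (chart_mapK cp). Qed.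

Lemma local_rep_dom c d x : map_dom c d x ->
  (chart_map d @` chart_dom d) (local_rep f c d x).
Proof. by move=> [p [cp dp] <-]; rewrite (local_repE _ cp); exists (f p). Qed.

Lemma local_rep_smooth c d : atlas c -> atlas d ->
  smooth_on (map_dom c d) (local_rep f c d).
Proof. by move=> ac ad; exact: f_smooth.2. Qed.

Definition density c d p : R :=
  energy_density_loc (g c) (h d) (local_rep f c d) (chart_map c p).

(** Near x the two local representatives differ by changes of charts on both sides; the Jacobians of
    these cancel in the trace against the transformation laws of the two metrics. *)
Lemma density_invariant c d c' d' p : atlas c -> atlas d -> atlas c' -> atlas d' ->
  chart_dom c p -> chart_dom d (f p) -> chart_dom c' p -> chart_dom d' (f p) ->
  density c d p = density c' d' p.
Proof.
move=> ac ad ac' ad' cp dp c'p d'p.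
set x := chart_map c p; set phi := chart_transition c c'.
set psi := chart_transition d' d.
have phix : phi x = chart_map c' p by rewrite /phi /chart_transition /= (chart_mapK cp).
have F'x : local_rep f c' d' (phi x) = chart_map d' (f p) by rewrite phix local_repE.
have dphi : differentiable phi x.
  by apply: (smooth_on_differentiable (atlas_smooth ac ac')); exists p.
have dF' : differentiable (local_rep f c' d') (phi x).
  apply: (smooth_on_differentiable (local_rep_smooth ac' ad')).
  by rewrite phix; exists p.
have dpsi : differentiable psi (local_rep f c' d' (phi x)).
  apply: (smooth_on_differentiable (atlas_smooth ad' ad)).
  by rewrite F'x; exists (f p).
have dF : differentiable (local_rep f c d) x.
  by apply: (smooth_on_differentiable (local_rep_smooth ac ad)); exists p.
have Fnear : \forall y \near x, local_rep f c d y = (psi \o (local_rep f c' d' \o phi)) y.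
  have oW : open ((f @^-1` chart_dom d) `&` (chart_dom c' `&` f @^-1` chart_dom d')).
    by do !apply: openI; try exact: preim_dom_open; exact: chart_dom_open.
  have := open_nbhs_nbhs (conj (chart_image_open (c := c) oW) _ : open_nbhs x _).
  move=> /(_ (ex_intro2 _ _ p (conj cp (conj dp (conj c'p d'p))) erefl)).
  apply: filterS => _ [q [cq [dq [c'q d'q]]] <-].
  rewrite (local_repE _ cq) /= /phi /chart_transition /= (chart_mapK cq).
  by rewrite (local_repE _ c'q) /psi /chart_transition /= (chart_mapK d'q).
have JE : 'J (local_rep f c d) x =
    'J phi x *m 'J (local_rep f c' d') (phi x) *m 'J psi (chart_map d' (f p)).
  rewrite (jacobian_near_eq Fnear dF).
  rewrite (jacobian_comp (differentiable_comp dphi dF') dpsi).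
  by rewrite (jacobian_comp dphi dF') /= F'x.
have Gc := metric_change g ac ac' cp c'p.
have Hd := metric_change h ad' ad d'p dp.
rewrite /= -/phi -/x in Gc; rewrite /= -/psi in Hd.
have uG : g c x \in unitmx.
  by apply: (metric_unit (chart_metric_onT g ac)); exists p.
rewrite /density /energy_density_loc -/x JE (local_repE _ cp) Gc.
rewrite -phix F'x phix Hd.
set A := 'J phi x; set B := 'J psi _; set E := 'J (local_rep f c' d') _.
rewrite Gc in uG; move: uG; rewrite !unitmx_mul => /andP[/andP[uA uG'] uAT].
rewrite invmx_mul ?unitmx_mul ?uA ?uAT// invmx_mul// !trmx_mul -!mulmxA.
rewrite mxtrace_mulC -!mulmxA (mulKmx uA).
by rewrite mulmxV// mulmx1 !mulmxA.
Qed.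

End EnergyDensity.

(** * Maximum of the energy density, curvature bounds, constancy *)

Section EnergyMaximum.
Context {R : realType} {n m : nat}.
Context {M : smoothManifold R n} {N : smoothManifold R m}.
Variables (g : riemannianMetric M) (h : riemannianMetric N) (f : M -> N).
Hypothesis f_smooth : smooth_map f.
Implicit Types (c : chart R n M) (d : chart R m N) (p q : M).

Lemma density_near c d p : atlas c -> atlas d -> chart_dom c p -> chart_dom d (f p) ->
  \forall q \near p, chart_dom c q /\ chart_dom d (f q).
Proof.
move=> ac ad cp dp.
have n1 := chart_dom_nbhs cp.
have n2 : nbhs p (f @^-1` chart_dom d).
  by apply: open_nbhs_nbhs; split => //; exact: preim_dom_open.
exact: filterI n1 n2.
Qed.

Lemma density_ge0 c d p : atlas c -> atlas d -> chart_dom c p -> chart_dom d (f p) ->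
  0 <= density g h f c d p.
Proof.
move=> ac ad cp dp.
apply: (energy_density_ge0 (map_dom_metric g f_smooth d ac) (chart_metric_onT h ad)
  (@local_rep_dom _ _ _ _ _ f c d)).
by exists p.
Qed.

Lemma density_continuous c d p : atlas c -> atlas d -> chart_dom c p ->
  chart_dom d (f p) -> {for p, continuous (density g h f c d : M -> R^o)}.
Proof.
move=> ac ad cp dp.
have su := smf_energy_density (map_dom_metric g f_smooth d ac) (chart_metric_onT h ad)
  (local_rep_smooth f_smooth ac ad) (@local_rep_dom _ _ _ _ _ f c d).
apply: (@continuous_comp _ _ _ (chart_map c)
  (energy_density_loc (g c) (h d) (local_rep f c d) : _ -> R^o)).
  exact: chart_map_continuous.
by apply: (smf_continuous su); exists p.
Qed.

Lemma energy_maximum : compact [set: M] -> [set: M] !=set0 ->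
  exists p, forall q c d c' d', atlas c -> atlas d -> atlas c' -> atlas d' ->
    chart_dom c p -> chart_dom d (f p) -> chart_dom c' q -> chart_dom d' (f q) ->
    density g h f c' d' q <= density g h f c d p.
Proof.
move=> cptM M0.
have /choice[cM cMP] : forall p : M, exists c, atlas c /\ chart_dom c p.
  by move=> p; have [c ac cp] := atlas_cover p; exists c.
have /choice[cN cNP] : forall p : N, exists d, atlas d /\ chart_dom d p.
  by move=> p; have [d ad dp] := atlas_cover p; exists d.
pose u p := density g h f (cM p) (cN (f p)) p.
have uE p c d : atlas c -> atlas d -> chart_dom c p -> chart_dom d (f p) ->
    density g h f c d p = u p.
  move=> ac ad cp dp; have [aM cMp] := cMP p; have [aN cNp] := cNP (f p).
  exact: density_invariant.
have cu : continuous (u : M -> R^o).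
  move=> p; have [aM cMp] := cMP p; have [aN cNp] := cNP (f p).
  rewrite /continuous_at /u.
  (* The chosen charts may jump from point to point; by invariance the charts chosen at p compute u
     on a whole neighbourhood of p. *)
  apply: cvg_trans (density_continuous aM aN cMp cNp).
  apply: (@near_eq_cvg _ _ (nbhs p)); apply: filterS (density_near aM aN cMp cNp).
  by move=> q [cq dq]; rewrite uE.
have [p _ pmax] := compact_EVT_max M0 cptM (continuous_subspaceT cu).
exists p => q c d c' d' ac ad ac' ad' cp dp cq dq.
rewrite (uE _ _ _ ac ad cp dp) (uE _ _ _ ac' ad' cq dq).
by apply: pmax; exact: in_setT.
Qed.

(** The value at p is an upper bound, so the supremum is genuine and not the default 0. *)
Lemma sup_sqnorm_max p : (forall q c d c' d', atlas c -> atlas d -> atlas c' -> atlas d' ->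
    chart_dom c p -> chart_dom d (f p) -> chart_dom c' q -> chart_dom d' (f q) ->
    density g h f c' d' q <= density g h f c d p) ->
  forall c d, atlas c -> atlas d -> chart_dom c p -> chart_dom d (f p) ->
  density g h f c d p <= sup_sqnorm_d g h f.
Proof.
move=> pmax c d ac ad cp dp; apply: ub_le_sup; last by exists c, d, p.
exists (density g h f c d p) => _ [c' [d' [q [ac' ad' cq dq ->]]]].
exact: (pmax q c d c' d').
Qed.

(** Pairs (X, Y) range over a noncompact set, but [sec_bound] dominates them all at a given point
    and is continuous along f, so compactness of M is enough. *)
Lemma sectional_bounded : compact [set: M] -> has_ubound (sectional_values h (range f)).
Proof.
move=> cptM.
pose P (C : R) (p : M) := forall d (X Y : 'rV[R]_m), atlas d -> chart_dom d (f p) ->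
  sectional (h d) (chart_map d (f p)) X Y <= C.
have : \forall C \near +oo%R, [set: M] `<=` P C.
  apply: ((compact_near_coveringP _).1 cptM) => p _.
  have [d ad dp] := atlas_cover (f p).
  have mH := chart_metric_onT h ad.
  pose B q := sec_bound (h d) (chart_map d (f q)).
  have cB : {for p, continuous (B : M -> R^o)}.
    have c1 : {for p, continuous (chart_map d \o f)}.
      by apply: continuous_comp; [exact: f_smooth.1|exact: chart_map_continuous].
    apply: (@continuous_comp _ _ _ (chart_map d \o f) (sec_bound (h d) : _ -> R^o) p c1).
    by apply: (smf_continuous (smf_sec_bound mH)); exists (f p).
  have nB : \forall q \near p, B q < B p + 1.
    have /cvgrPdist_lt /(_ 1 ltr01) := cB; apply: filterS => q.
    rewrite distrC ltr_norml => /andP[_]; rewrite ltrBlDl; apply.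
  have nd : \forall q \near p, chart_dom d (f q).
    by apply: open_nbhs_nbhs; split => //; exact: preim_dom_open.
  exists ([set q | B q < B p + 1 /\ chart_dom d (f q)], [set C | B p + 1 < C]) => /=.
    by split; [exact: filterI nB nd|exact: (nbhs_pinfty_gt (num_real _))].
  move=> [q C] /= [[Bq dq] BC] d' X Y ad' d'q.
  (* The arbitrary chart at f q is traded for the fixed chart d around f p, in which [B] is
     computed. *)
  have [X' [Y' ->]] := chart_change_sectional h X Y ad' ad d'q dq.
  have Vq : (chart_map d @` chart_dom d) (chart_map d (f q)) by exists (f q).
  apply: ltW; apply: le_lt_trans BC; apply: le_trans (ltW Bq).
  have := sec_num_le mH X' Y' Vq; have := sec_den_ge0 mH X' Y' Vq.
  rewrite le_eqVlt => /orP[/eqP d0 _|d0].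
    (* A degenerate pair has sectional curvature 0, since division by 0 gives 0. *)
    by rewrite /sectional -/(sec_den _ _ _ _) -d0 invr0 mulr0 sec_bound_ge0.
  by rewrite -ler_pdivrMr.
move=> /filter_ex[C PC]; exists C => _ [d [_ [X [Y [[p _ <-] ad dp _ ->]]]]].
exact: PC.
Qed.

Lemma sec_num_le_max d p (X Y : 'rV[R]_m) : compact [set: M] ->
  (forall s, sectional_values h (range f) s -> 0 <= s) ->
  atlas d -> chart_dom d (f p) ->
  sec_num (h d) (chart_map d (f p)) X Y <=
  sectional_max h (range f) * sec_den (h d) (chart_map d (f p)) X Y.
Proof.
move=> cptM sec0 ad dp; have mH := chart_metric_onT h ad.
have Vp : (chart_map d @` chart_dom d) (chart_map d (f p)) by exists (f p).
have [fXY|nXY] := boolP (free [:: X; Y]).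
  have d0 := sec_den_gt0 mH Vp fXY.
  rewrite -ler_pdivrMr//; apply: ub_le_sup; first exact: sectional_bounded.
  by exists d, (f p), X, Y; split => //; exists p.
(* A dependent pair has numerator 0, so only the sign of the supremum matters; where no supremum
   exists, it is 0 by default. *)
rewrite (sec_num_not_free mH Vp nXY); apply: mulr_ge0; last exact: (sec_den_ge0 mH).
have [[[s sv] sb]|ns] := pselect (has_sup (sectional_values h (range f))).
  by apply: le_trans (sec0 _ sv) _; exact: ub_le_sup.
by rewrite /sectional_max sup_out.
Qed.

Lemma sectional_max_ge0 : (forall s, sectional_values h (range f) s -> 0 <= s) ->
  0 <= sectional_max h (range f).
Proof.
move=> sec0.
have [[[s sv] sb]|ns] := pselect (has_sup (sectional_values h (range f))).
  by apply: le_trans (sec0 _ sv) _; exact: ub_le_sup.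
by rewrite /sectional_max sup_out.
Qed.

Lemma sup_sqnorm_ge0 : 0 <= sup_sqnorm_d g h f.
Proof.
have [[[s sv] sb]|ns] := pselect (has_sup (sqnorm_d_values g h f)).
  move: (sv) => [c [d [p [ac ad cp dp sE]]]].
  by apply: le_trans (ub_le_sup sb sv); rewrite sE; exact: density_ge0.
by rewrite /sup_sqnorm_d sup_out.
Qed.

Lemma density0_locally_constant :
  (forall c d p, atlas c -> atlas d -> chart_dom c p -> chart_dom d (f p) ->
    density g h f c d p = 0) ->
  forall p, \forall q \near p, f q = f p.
Proof.
move=> u0 p.
have [c ac cp] := atlas_cover p; have [d ad dp] := atlas_cover (f p).
have mG := map_dom_metric g f_smooth d ac; have mH := chart_metric_onT h ad.
have sF := local_rep_smooth f_smooth ac ad.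
have oU := metric_on_open mG.
have J0 x : map_dom f c d x -> 'J (local_rep f c d) x = 0.
  move=> [q [cq dq] <-].
  apply: (energy_density_eq0 mG mH (@local_rep_dom _ _ _ _ _ f c d)).
    by exists q.
  exact: u0.
have Ux : map_dom f c d (chart_map c p) by exists p.
have /nbhs_ballP[r /= r0 rU] := open_nbhs_nbhs (conj oU Ux).
have cst y : ball (chart_map c p) r y ->
    local_rep f c d y = local_rep f c d (chart_map c p).
  move=> By; apply/rowP => a.
  apply: (pd0_ball_cst (f := fun z => local_rep f c d z 0 a) (r := r)) => //.
    by apply: smf_sub rU _; exact: smooth_on_smf.
  move=> i z Bz; have Uz := rU _ Bz.
  rewrite -(jacobianE _ _ (smooth_on_differentiable sF Uz)).
  by rewrite (J0 _ Uz) mxE.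
have nB : \forall q \near p, ball (chart_map c p) r (chart_map c q).
  by apply: (chart_map_continuous cp); exact: nbhsx_ballx.
apply: filterS (filterI nB (density_near ac ad cp dp)) => q [Bq [cq dq]].
have := cst _ Bq; rewrite !local_repE// => /(congr1 (chart_inv d)).
by rewrite (chart_mapK dq) (chart_mapK dp).
Qed.

(** The level set of f through p is nonempty, open and closed. *)
Lemma locally_constant_connected : connected [set: M] ->
  (forall p, \forall q \near p, f q = f p) -> forall p q, f q = f p.
Proof.
move=> conM lc p q.
have : [set q | f q = f p] = [set: M].
  apply: conM.
  - by exists p.
  - exists [set q | f q = f p]; last by rewrite setTI.
    by rewrite openE => q' /= q'p; apply: filterS (lc q') => q'' /= ->.
  - exists [set q | f q = f p]; last by rewrite setTI.
    rewrite -openC openE => q' /= q'p; apply: filterS (lc q') => q''.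
    by rewrite /setC /= => ->.
by move=> e; have : [set: M] q by []; rewrite -e.
Qed.

End EnergyMaximum.

Lemma ricci_min_le (R : realType) n (M : smoothManifold R n) (g : riemannianMetric M)
    (c : chart R n M) p (X : 'rV[R]_n) :
  has_inf (ricci_values g) -> atlas c -> chart_dom c p ->
  ricci_min g * inner (g c) (chart_map c p) X X <= ricci (g c) (chart_map c p) X X.
Proof.
move=> [_ lb] ac cp; set x := chart_map c p.
have mG := chart_metric_onT g ac.
have Ux : (chart_map c @` chart_dom c) x by exists p.
(* Ricci is homogeneous of degree 2, which reduces the estimate to unit vectors. *)
have rZ a Y : ricci (g c) x (a *: Y) (a *: Y) = a ^+ 2 * ricci (g c) x Y Y.
  rewrite !ricciE mulr_sumr; apply: eq_bigr => i _; rewrite mulr_sumr.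
  by apply: eq_bigr => j _; rewrite !scalemxE; ring.
have [->|X0] := eqVneq X 0.
  by have := rZ 0 0; rewrite inner0l mulr0 scale0r expr0n mul0r => ->.
have XX := inner_gt0 mG Ux X0.
pose s := Num.sqrt (inner (g c) x X X).
have s2 : s ^+ 2 = inner (g c) x X X by rewrite sqr_sqrtr// ltW.
have s0 : s != 0 by rewrite gt_eqF// sqrtr_gt0.
have XE : X = s *: (s^-1 *: X) by rewrite scalerA mulfV// scale1r.
rewrite [in leRHS]XE rZ s2 mulrC ler_pM2l//; apply: ge_inf => //.
exists c, p, (s^-1 *: X); split => //.
by rewrite innerZl innerZr -/x -s2; field.
Qed.

Theorem mainTheorem1 (R : realType) (n m : nat)
  (M : smoothManifold R n) (g : riemannianMetric M)
  (N : smoothManifold R m) (h : riemannianMetric N)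
  (M_connected : connected [set: M]) (M_compact : compact [set: M])
  (N_connected : connected [set: N])
  (f : M -> N) (f_smooth : smooth_map f) (f_harmonic : harmonic_map g h f)
  (sec_ge0 : forall s, sectional_values h (range f) s -> 0 <= s)
  (ric_gt : (n%:R - 1) / n%:R * sectional_max h (range f) * sup_sqnorm_d g h f
            < ricci_min g) :
  exists q : N, forall p : M, f p = q.
Proof.
set kappa := sectional_max h (range f) in ric_gt.
have k0 : 0 <= kappa := sectional_max_ge0 sec_ge0.
have sup0 := sup_sqnorm_ge0 g h f_smooth.
(* In dimension 0 the quotient is 0, because the inverse of 0 is 0. *)
have a0 : 0 <= (n%:R - 1) / n%:R :> R.
  case: (n) => [|n']; first by rewrite invr0 mulr0.
  by rewrite divr_ge0// subr_ge0 ler1n.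
have rho0 : 0 < ricci_min g.
  by apply: le_lt_trans ric_gt; apply: mulr_ge0 => //; exact: mulr_ge0.
(* inf is 0 on a set that is empty or not bounded below. *)
have hinf : has_inf (ricci_values g).
  by apply: contrapT => ni; move: rho0; rewrite /ricci_min inf_out// ltxx.
have [[_ [c0 [p0 [X0 [ac0 cp0 X01 _]]]]] _] := hinf.
(* A Ricci value comes with a point and a unit vector: M is nonempty and its dimension is
   positive. *)
have n0 : (0 < n)%N.
  rewrite lt0n; apply/eqP => n0; move: X01; subst n.
  rewrite (thinmx0 X0) inner0l => /esym/eqP; rewrite oner_eq0//.
have [p pmax] := energy_maximum g h f_smooth M_compact (ex_intro _ p0 I).
have [c ac cp] := atlas_cover p; have [d ad dp] := atlas_cover (f p).
have mG := map_dom_metric g f_smooth d ac; have mH := chart_metric_onT h ad.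
have sF := local_rep_smooth f_smooth ac ad.
have Ux : map_dom f c d (chart_map c p) by exists p.
have B := bochner_max (rho := ricci_min g) (kappa := kappa) mG mH sF
  (@local_rep_dom _ _ _ _ _ f c d) n0 Ux.
have {}B : ricci_min g * density g h f c d p <=
    kappa * ((n%:R - 1) / n%:R) * density g h f c d p ^+ 2.
  apply: B.
  - by move=> _ [q [cq dq] <-]; exact: f_harmonic.
  - by move=> _ [q [cq dq] <-]; exact: (pmax q c d c d ac ad ac ad cp dp cq dq).
  - by move=> X; exact: ricci_min_le.
  - exact: k0.
  - by move=> X Y; rewrite (local_repE f d cp); exact: sec_num_le_max.
have u0 := density_ge0 g h f_smooth ac ad cp dp.
have us := sup_sqnorm_max pmax ac ad cp dp.
have up0 : density g h f c d p = 0.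
  (* If u(p) > 0, dividing [B] by it bounds the Ricci minimum by (n-1)/n kappa u(p), hence by the
     same expression with the supremum of |df|^2, against the strict pinching. *)
  apply/eqP; rewrite eq_le u0 andbT leNgt; apply/negP => upos.
  have : kappa * ((n%:R - 1) / n%:R) * density g h f c d p < ricci_min g.
    apply: le_lt_trans ric_gt; rewrite [X in X * _ <= _]mulrC.
    by rewrite ler_wpM2l// mulr_ge0.
  rewrite ltNge => /negP; apply.
  by move: B; rewrite expr2 mulrA ler_pM2r.
have u00 c' d' q : atlas c' -> atlas d' -> chart_dom c' q -> chart_dom d' (f q) ->
    density g h f c' d' q = 0.
  move=> ac' ad' cq dq; apply/eqP; rewrite eq_le.
  rewrite (density_ge0 g h f_smooth ac' ad' cq dq) andbT -up0.
  exact: (pmax q c d c' d' ac ad ac' ad' cp dp cq dq).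
exists (f p) => q.
exact: (locally_constant_connected M_connected (density0_locally_constant f_smooth u00)).
Qed.
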